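(* The rectangular chromatic guarding number that is always sufficient and sometimes necessary for covering an orthogonal polygon with $n$ vertices is $\Theta(\log n)$. That is: (sufficiency) there is a constant $C>0$ such that $\chi_G^{rec}(P)\le C\log n$ for every $n\ge 4$ and every simple orthogonal polygon $P$ with $n$ vertices; and (necessity) there is a constant $c>0$ such that for arbitrarily large $n$ there exists a simple orthogonal polygon $P$ with $n$ vertices and $\chi_G^{rec}(P)\ge c\log n$.
   Context: A polygon $P$ is a connected simple subset of $\mathbb{R}^2$ with polygonal boundary; it is orthogonal (rectilinear) if all its edges are horizontal or vertical. Two points $p,q$ of an orthogonal polygon $P$ are rectangularly visible (r-visible) if the axis-aligned rectangle with $p$ and $q$ as opposite corners lies totally inside $P$. For $p\in P$, $V^{rec}(p)=\{q\in P : p \text{ is rectangularly visible from } q\}$. An r-guard is a guard placed at a point $p\in P$ which sees exactly $V^{rec}(p)$. A guard set (of r-guards) is a finite set $S$ of points of $P$ with $\bigcup_{s\in S}V^{rec}(s)=P$. Two guards $s,t\in S$ are incompatible if $V^{rec}(s)\cap V^{rec}(t)\neq\emptyset$. $C(S)$ is the minimum number of colors needed to color the guards of $S$ so that every pair of incompatible guards gets different colors. The rectangular chromatic guarding number is $\chi_G^{rec}(P)=\min_S C(S)$, the minimum over all guard sets $S$ of r-guards in $P$. *)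

(* Defs.v *)
From HB Require Import structures.
From mathcomp Require Export all_boot all_order all_algebra.
From mathcomp Require Export all_classical all_reals all_analysis.
Export Order.TTheory GRing.Theory Num.Theory.
Export numFieldNormedType.Exports.

Set Implicit Arguments.
Unset Strict Implicit.
Unset Printing Implicit Defensive.

Local Open Scope classical_set_scope.
Local Open Scope ring_scope.

Definition segment (R : realType) (a b : R * R) : set (R * R) :=
  [set z | exists t : R, [/\ 0 <= t, t <= 1 &
     z = ((1 - t) * a.1 + t * b.1, (1 - t) * a.2 + t * b.2)]].

Definition collinear (R : realType) (a b c : R * R) : Prop :=
  (b.1 - a.1) * (c.2 - b.2) = (b.2 - a.2) * (c.1 - b.1).

(* Indices are cyclic: [ordS i] is i + 1 modulo n. *)
Definition edge (R : realType) (n : nat) (v : 'I_n -> R * R) (i : 'I_n) :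
    set (R * R) :=
  segment (v i) (v (ordS i)).

(* The non-collinearity clause makes every [v i] a genuine corner, so that n
   really is the number of vertices; it also excludes edges of length 0. *)
Definition simple_closed_chain (R : realType) (n : nat)
    (v : 'I_n -> R * R) : Prop :=
  [/\ (2 < n)%N,
      forall i, ~ collinear (v i) (v (ordS i)) (v (ordS (ordS i))),
      forall i, edge v i `&` edge v (ordS i) = [set v (ordS i)]
    & forall i j, j != i -> j != ordS i -> i != ordS j ->
        edge v i `&` edge v j = set0].

Definition orthogonal_chain (R : realType) (n : nat)
    (v : 'I_n -> R * R) : Prop :=
  forall i, (v i).1 = (v (ordS i)).1 \/ (v i).2 = (v (ordS i)).2.

Definition frontier (T : topologicalType) (A : set T) : set T :=
  closure A `\` A°.

(* A polygon is the closed region enclosed by a simple closed chain.  Regular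
   closedness is needed to rule out the chain itself, which is compact,
   connected and equal to its own frontier. *)
Definition orthogonal_polygon (R : realType) (n : nat) (P : set (R * R)) :
    Prop :=
  [/\ compact P, connected P, regclosed P &
      exists v : 'I_n -> R * R,
        [/\ simple_closed_chain v, orthogonal_chain v &
            frontier P = \bigcup_(i in [set: 'I_n]) edge v i]].

Definition rectangle (R : realType) (p q : R * R) : set (R * R) :=
  [set z | Num.min p.1 q.1 <= z.1 <= Num.max p.1 q.1 /\
           Num.min p.2 q.2 <= z.2 <= Num.max p.2 q.2].

Definition rvisible (R : realType) (P : set (R * R)) (p q : R * R) : Prop :=
  rectangle p q `<=` P.

Definition Vrec (R : realType) (P : set (R * R)) (p : R * R) : set (R * R) :=
  [set q | P q /\ rvisible P p q].

Definition guard_set (R : realType) (P S : set (R * R)) : Prop :=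
  [/\ finite_set S, S `<=` P & \bigcup_(s in S) Vrec P s = P].

Definition incompatible (R : realType) (P : set (R * R)) (s t : R * R) : Prop :=
  s <> t /\ Vrec P s `&` Vrec P t !=set0.

Definition colorable (R : realType) (P S : set (R * R)) (k : nat) : Prop :=
  exists f : R * R -> nat,
    (forall s, S s -> (f s < k)%N) /\
    (forall s t, S s -> S t -> incompatible P s t -> f s <> f t).

(* In the next two definitions the infimum is over a set of naturals, hence a
   minimum as soon as that set is nonempty; it is +oo, not 0, if it is empty. *)
Definition color_number (R : realType) (P S : set (R * R)) : \bar R :=
  ereal_inf [set k%:R%:E | k in [set k | colorable P S k]].

Definition chi_rec (R : realType) (P : set (R * R)) : \bar R :=
  ereal_inf [set color_number P S | S in [set S | guard_set P S]].

(* Main.v *)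
Require Import Defs.
From mathcomp Require Import zify ring lra.

(** Upper bound.  Index the coordinates relative to those of the vertices, odd
    indices being vertex lines and even ones the gaps between them; [P] becomes
    a finite set of cells and r-visibility becomes visibility in that set.  A
    parity argument on the boundary shows that a maximal run of cells in a row
    separates its two sides.  Starting from one run, add alternately everything
    seen vertically and everything seen horizontally.  A guard sees only its own
    layer and the two adjacent ones, so three colour classes deal with different
    layers.  Inside one layer, the cells on one side of the previous layers form
    a forest, and two cells have a common visible cell only if they are
    comparable in it; cut the forest into paths by the logarithm of the subtree
    size, as in a heavy path decomposition, and let one guard serve each path.

    Lower bound.  Take the histogram whose column heights are given by the ruler
    sequence.  Any dyadic block of columns needs a guard below the top of its
    middle column and within the block; descend to the half block not containing
    this guard.  The guards met on the way see a common point of the base. *)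

Set Implicit Arguments.
Unset Strict Implicit.
Unset Printing Implicit Defensive.

(** * Visibility layers *)

Section Cells.
Local Open Scope nat_scope.

(** Planarity enters the colouring only through [sepH], for the cells and for their transpose, so no
    Jordan curve theorem is needed for the polygon itself. Vertex lines are cells of their own
    because [P] is closed: visibility along an edge counts, and a run inside a vertex line may be
    longer than the runs in the gaps next to it. The logarithm is taken of the number of cells, at
    most [(2 * n + 1) ^ 2]; any polynomial bound would do, since it only changes the constant. Each
    of the three residues of the layer index takes one set of colours for either side of the
    previous layer, and the starting run takes one more colour, hence [6 * colours N + 1]. In the
    other direction, the ruler histogram with [2 ^ d - 1] columns has [2 ^ d.+1] vertices and forces
    [d] colours, one for each halving. *)

Definition cell := (nat * nat)%type.

Definition btw (a b k : nat) : bool := (a <= k <= b) || (b <= k <= a).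

Definition hseg (M : cell -> Prop) y a b := forall i, btw a b i -> M (i, y).
Definition vseg (M : cell -> Prop) x a b := forall j, btw a b j -> M (x, j).
Definition rvis (M : cell -> Prop) (p q : cell) :=
  forall i j, btw p.1 q.1 i -> btw p.2 q.2 j -> M (i, j).

Definition adj (c d : cell) : bool :=
  ((c.1 == d.1) && ((d.2 == c.2.+1) || (c.2 == d.2.+1))) ||
  ((c.2 == d.2) && ((d.1 == c.1.+1) || (c.1 == d.1.+1))).

Inductive conn (A : cell -> Prop) (a : cell) : cell -> Prop :=
| conn_refl : A a -> conn A a a
| conn_step b c : conn A a b -> adj b c -> A c -> conn A a c.

Definition hrun (M : cell -> Prop) (p c : cell) :=
  c.2 = p.2 /\ hseg M p.2 p.1 c.1.
Definition vrun (M : cell -> Prop) (p c : cell) :=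
  c.1 = p.1 /\ vseg M p.1 p.2 c.2.

Definition off_run M p (z : cell) := M z /\ ~ hrun M p z.

(** The version for cells of the fact that a maximal chord cuts a simply connected region. *)
Definition sepH (M : cell -> Prop) := forall p x x',
  hseg M p.2 p.1 x -> hseg M p.2 p.1 x' ->
  ~ conn (off_run M p) (x, p.2.-1) (x', p.2.+1).

Definition swap (c : cell) : cell := (c.2, c.1).

Lemma adj_sym a b : adj a b = adj b a.
Proof. rewrite /adj; lia. Qed.

Lemma conn_l A a b : conn A a b -> A a.
Proof. by elim. Qed.

Lemma conn_r A a b : conn A a b -> A b.
Proof. by case. Qed.

Lemma conn_trans A a b c : conn A a b -> conn A b c -> conn A a c.
Proof. move=> ab; elim=> // d e _ ad de Ae; exact: conn_step ad de Ae. Qed.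

Lemma conn_sym A a b : conn A a b -> conn A b a.
Proof.
elim=> [Aa|c d ac ca cd Ad]; first exact: conn_refl.
apply: conn_trans ca; apply: (@conn_step _ _ d); first exact: conn_refl.
  by rewrite adj_sym.
exact: conn_r ac.
Qed.

Lemma conn_map (A B : cell -> Prop) (f : cell -> cell) a b :
  (forall c, A c -> B (f c)) ->
  (forall c d, A c -> A d -> adj c d -> adj (f c) (f d)) ->
  conn A a b -> conn B (f a) (f b).
Proof.
move=> AB fadj; elim=> [Aa|c d ac IH cd Ad]; first exact/conn_refl/AB.
apply: conn_step IH _ (AB _ Ad); apply: fadj => //; exact: conn_r ac.
Qed.

Lemma conn_sub (A B : cell -> Prop) a b :
  (forall c, A c -> B c) -> conn A a b -> conn B a b.
Proof. by move=> AB; apply: (@conn_map A B id). Qed.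

Lemma vseg_conn A x a b : vseg A x a b -> conn A (x, a) (x, b).
Proof.
move=> Aab; wlog ab : a b Aab / a <= b.
  move=> H; case: (leqP a b) => [/H|/ltnW ba]; first exact.
  by apply/conn_sym/H => // j jb; apply: Aab; move: jb; rewrite /btw; lia.
have {Aab} Aab j : a <= j <= b -> A (x, j) by move=> h; apply: Aab; rewrite /btw h.
elim: b ab Aab => [|b IH] ab Aab.
  have -> : a = 0 by lia.
  by apply: conn_refl; apply: Aab; lia.
have [->|ltab] : a = b.+1 \/ a <= b by lia.
  by apply: conn_refl; apply: Aab; lia.
apply: (@conn_step _ _ (x, b)); last by apply: Aab; lia.
  by apply: IH => // j jb; apply: Aab; lia.
rewrite /adj /=; lia.
Qed.

Lemma hseg_conn A y a b : hseg A y a b -> conn A (a, y) (b, y).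
Proof.
move=> h; have := @vseg_conn (fun c => A (swap c)) y a b h.
move/(@conn_map _ A swap); apply=> // c d _ _; rewrite /adj /=; lia.
Qed.

Lemma hrun_sym M p c : hrun M p c -> hrun M c p.
Proof.
case=> e h; split=> // i hi; rewrite e; apply: h; move: hi; rewrite /btw; lia.
Qed.

Lemma hrun_refl M p : M p -> hrun M p p.
Proof.
move=> Mp; split=> // i hi; have -> : i = p.1 by move: hi; rewrite /btw; lia.
by case: p Mp {hi}.
Qed.

Lemma hseg_trans M y a b c : hseg M y a b -> hseg M y b c -> hseg M y a c.
Proof.
move=> h1 h2 i hi; have [|] : btw a b i \/ btw b c i by move: hi; rewrite /btw; lia.
- exact: h1.
- exact: h2.
Qed.

Lemma hseg_sym M y a b : hseg M y a b -> hseg M y b a.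
Proof. by move=> h i hi; apply: h; move: hi; rewrite /btw; lia. Qed.

Lemma hseg_sub M y a b c d :
  hseg M y a b -> btw a b c -> btw a b d -> hseg M y c d.
Proof. by move=> h hc hd i hi; apply: h; move: hi hc hd; rewrite /btw; lia. Qed.

Lemma vseg_sub M x a b c d :
  vseg M x a b -> btw a b c -> btw a b d -> vseg M x c d.
Proof. by move=> h hc hd i hi; apply: h; move: hi hc hd; rewrite /btw; lia. Qed.

Lemma ex_min (T : Type) (Q : T -> Prop) (f : T -> nat) :
  (exists c, Q c) -> exists c, Q c /\ forall d, Q d -> f c <= f d.
Proof.
case=> c Qc.
have ex : exists n, `[< exists2 c, Q c & f c = n >] by exists (f c); apply/asboolP; exists c.
case: (ex_minnP ex) => m /asboolP[d Qd <-] min.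
by exists d; split=> // e Qe; apply: min; apply/asboolP; exists e.
Qed.

(** * The forest on one side of a connected set of cells *)

Section Level.
Variables (M D : cell -> Prop) (N : nat).
Hypothesis sepM : sepH M.
Hypothesis bndM : forall c, M c -> c.1 < N /\ c.2 < N.
Hypothesis subD : forall c, D c -> M c.
Hypothesis runD : forall c d, D c -> hrun M c d -> D d.
Hypothesis conD : forall c d, D c -> D d -> conn D c d.

(** Only the side of larger row indices; the other side is reached through [flip]. *)
Definition above (c : cell) : Prop :=
  ~ D c /\ exists y, [/\ y < c.2, D (c.1, y) & vseg M c.1 y c.2].

(* The forest order on the runs of cells [above] [D]; a cell stands for its run. *)
Definition below (p q : cell) : Prop :=
  [/\ p.2 <= q.2, hseg M p.2 p.1 q.1 & vseg M q.1 p.2 q.2].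

Lemma above_in c : above c -> M c.
Proof. by case=> _ [y [yc _ h]]; case: c yc h => c1 c2 /= yc; apply; rewrite /btw; lia. Qed.

Lemma D_off p c : above p -> D c -> off_run M p c.
Proof.
move=> [Dp _] Dc; split; first exact: subD.
by move=> /hrun_sym h; apply: Dp; apply: runD h.
Qed.

Lemma rows_off p c : M c -> c.2 <> p.2 -> off_run M p c.
Proof. by move=> Mc cp; split=> // -[]. Qed.

(* Otherwise [D] would link the cell below [p] to the cell above it without
   crossing the run of [p]. *)
Lemma below_of_conn p p' x : above p -> above p' -> p.2 <= p'.2 ->
  hseg M p.2 p.1 x ->
  conn (off_run M p) p' (x, p.2.+1) -> below p p'.
Proof.
move=> ap ap' le hx cn.
have [_ [y [yp Dy vy]]] := ap; have [_ [y' [yp' Dy' vy']]] := ap'.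
case: (pselect (hseg M p.2 p.1 p'.1)) => [h|nh]; last first.
  exfalso; apply: (sepM (p := p) (x := p.1) (x' := x)) => //.
    by apply: hseg_sub hx _ _; rewrite /btw; lia.
  apply: conn_trans cn; apply: (@conn_trans _ _ (p.1, y)).
    apply: vseg_conn => j hj; apply: rows_off => /=; last by move: hj; rewrite /btw; lia.
    by apply: vy; move: hj; rewrite /btw; lia.
  apply: (@conn_trans _ _ (p'.1, y')).
    by apply: (conn_sub (A := D)) (conD _ _) => // c; exact: D_off.
  rewrite [X in conn _ _ X]surjective_pairing.
  apply: vseg_conn => j hj; split; first exact: vy'.
  by case=> /= _.
(* If column [p'.1] leaves [D] only over the row of [p], its part from [y'] to [p'] avoids the run
   as well, and the same contradiction arises. *)
case: (leqP y' p.2) => [le'|gt']; first by split=> //; apply: vseg_sub vy' _ _; rewrite /btw; lia.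
exfalso; apply: (sepM (p := p) (x := p.1) (x' := x)) => //.
  by apply: hseg_sub hx _ _; rewrite /btw; lia.
apply: conn_trans cn; apply: (@conn_trans _ _ (p.1, y)).
  apply: vseg_conn => j hj; apply: rows_off => /=; last by move: hj; rewrite /btw; lia.
  by apply: vy; move: hj; rewrite /btw; lia.
apply: (@conn_trans _ _ (p'.1, y')).
  by apply: (conn_sub (A := D)) (conD _ _) => // c; exact: D_off.
rewrite [X in conn _ _ X]surjective_pairing.
apply: vseg_conn => j hj; apply: rows_off => /=; last by move: hj; rewrite /btw; lia.
exact: vy'.
Qed.

Lemma below_refl p : M p -> below p p.
Proof.
case: p => a b Mp; split=> //= i hi.
  by have -> : i = a by move: hi; rewrite /btw; lia.
by have -> : i = b by move: hi; rewrite /btw; lia.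
Qed.

Lemma below_row p q : p.2 = q.2 -> hseg M p.2 p.1 q.1 -> below p q.
Proof.
move=> e h; split=> //; first by rewrite e.
move=> j hj; have -> : j = p.2 by move: hj; rewrite /btw; lia.
apply: h; rewrite /btw; lia.
Qed.

(** Not a formal consequence: [below p r] asks for a straight column at [r.1], while the hypotheses
    give a path bent at the row of [q]. That path stays in rows over [p], and [below_of_conn]
    straightens it. *)
Lemma below_trans p q r : above p -> above r -> below p q -> below q r -> below p r.
Proof.
move=> ap ar [l1 h1 v1] [l2 h2 v2].
have [e|lt] : p.2 = q.2 \/ p.2 < q.2 by lia.
  by split; [lia | rewrite e in h1 *; apply: hseg_trans h1 h2 | rewrite e].
apply: (@below_of_conn _ _ q.1) => //; first lia.
have off i j : M (i, j) -> p.2 < j -> off_run M p (i, j).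
  by move=> Mi lj; apply: rows_off => //=; lia.
apply: (@conn_trans _ _ (r.1, q.2)).
  rewrite [X in conn _ X]surjective_pairing; apply: vseg_conn => j hj.
  by apply: off; [apply: v2; move: hj; rewrite /btw; lia | move: hj; rewrite /btw; lia].
apply: (@conn_trans _ _ (q.1, q.2)).
  apply: hseg_conn => j hj.
  by apply: off; [apply: h2; move: hj; rewrite /btw; lia | lia].
apply: vseg_conn => j hj.
by apply: off; [apply: v1; move: hj; rewrite /btw; lia | move: hj; rewrite /btw; lia].
Qed.

(** Both runs meet the column of [q]: follow the run of [p'] to that column and descend to the cell
    over the run of [p]. Hence the predecessors of a cell form a chain, which makes the order a
    forest. *)
Lemma below_tree p p' q : above p -> above p' -> p.2 <= p'.2 ->
  below p q -> below p' q -> below p p'.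
Proof.
move=> ap ap' le [l1 h1 v1] [l2 h2 v2].
have [e|lt] : p.2 = p'.2 \/ p.2 < p'.2 by lia.
  apply: below_row => //; apply: hseg_trans h1 _; rewrite e; exact: hseg_sym.
apply: (@below_of_conn _ _ q.1) => //.
have off i j : M (i, j) -> p.2 < j -> off_run M p (i, j).
  by move=> Mi lj; apply: rows_off => //=; lia.
apply: (@conn_trans _ _ (q.1, p'.2)).
  rewrite [X in conn _ X]surjective_pairing; apply: hseg_conn => j hj.
  by apply: off; [apply: h2; move: hj; rewrite /btw; lia | lia].
apply: vseg_conn => j hj.
by apply: off; [apply: v1; move: hj; rewrite /btw; lia | move: hj; rewrite /btw; lia].
Qed.

(** This is why guards incomparable in the forest may share a colour. If [q] is not over the row of
    [g], that row crosses both rectangles; otherwise the path from [g'] through the row of [q] down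
    to the cell over [g] avoids the run of [g]. *)
Lemma common_below g g' q : above g -> above g' -> g.2 <= g'.2 ->
  rvis M g q -> rvis M g' q -> below g g'.
Proof.
move=> ag ag' le r1 r2.
have [lq|lq] := leqP q.2 g.2.
  split=> //.
    move=> i hi.
    have [|] : btw g.1 q.1 i \/ btw g'.1 q.1 i by move: hi; rewrite /btw; lia.
      by move=> h; apply: r1; rewrite // /btw; lia.
    by move=> h; apply: r2; rewrite // /btw; lia.
  move=> j hj; apply: r2; move: hj; rewrite /btw; lia.
have [e|ne] := pselect (hrun M g g').
  by apply: below_row; case: e.
apply: (@below_of_conn _ _ g.1) => //.
  by move=> i hi; apply: r1; move: hi; rewrite /btw; lia.
apply: (@conn_trans _ _ (g'.1, q.2)).
  rewrite [X in conn _ X]surjective_pairing; apply: vseg_conn => j hj.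
  split; first by apply: r2; move: hj; rewrite /btw; lia.
  case=> /= ej h; apply: ne; split; last exact: h.
  by move: hj; rewrite /btw; lia.
apply: (@conn_trans _ _ (g.1, q.2)).
  apply: hseg_conn => i hi; apply: rows_off => /=; last lia.
  have [|] : btw g.1 q.1 i \/ btw g'.1 q.1 i by move: hi; rewrite /btw; lia.
    by move=> h; apply: r1; rewrite // /btw; lia.
  by move=> h; apply: r2; rewrite // /btw; lia.
apply: vseg_conn => j hj; apply: rows_off => /=; last by move: hj; rewrite /btw; lia.
by apply: r1; move: hj; rewrite /btw; lia.
Qed.

(* Otherwise a run starting on the left side would separate the two vertical
   neighbours of its first cell, which the rest of the boundary joins. *)
Lemma fill a b c d : a <= b -> c <= d ->
  hseg M c a b -> hseg M d a b -> vseg M a c d -> vseg M b c d ->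
  rvis M (a, c) (b, d).
Proof.
move=> ab cd hc hd va vb i j /= hi hj.
have Maj : M (a, j) by apply: va.
case: (pselect (hseg M j a b)) => [|nh]; first by apply.
have [e|[e|lt]] : j = c \/ (j = d \/ c < j < d) by move: hj; rewrite /btw; lia.
- by rewrite e in nh.
- by rewrite e in nh.
have offb y : M (b, y) -> off_run M (a, j) (b, y).
  by move=> Mxy; split=> //; case=> /= _.
exfalso; apply: (sepM (p := (a, j)) (x := a) (x' := a)) => /=.
- by move=> k hk; have -> : k = a by move: hk; rewrite /btw; lia.
- by move=> k hk; have -> : k = a by move: hk; rewrite /btw; lia.
apply: (@conn_trans _ _ (a, c)).
  apply: vseg_conn => k hk; apply: rows_off => /=; last by move: hk; rewrite /btw; lia.
  by apply: va; move: hk; rewrite /btw; lia.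
apply: (@conn_trans _ _ (b, c)).
  apply: hseg_conn => k hk; apply: rows_off => /=; last lia.
  exact: hc.
apply: (@conn_trans _ _ (b, d)).
  by apply: vseg_conn => k hk; apply: offb; apply: vb.
apply: (@conn_trans _ _ (a, d)).
  apply: hseg_conn => k hk; apply: rows_off => /=; last lia.
  by apply: hd; move: hk; rewrite /btw; lia.
apply: vseg_conn => k hk; apply: rows_off => /=; last by move: hk; rewrite /btw; lia.
by apply: va; move: hk; rewrite /btw; lia.
Qed.

(** The subtree at [p], as a finite set so that it has a cardinality. It counts cells instead of
    runs, which still gives at most [N * N]. *)
Definition cone (p : cell) : {set 'I_N * 'I_N} :=
  [set q : 'I_N * 'I_N | `[< above (val q.1, val q.2) /\ below p (val q.1, val q.2) >]]%SET.

Lemma coneP p z : reflect (above (val z.1, val z.2) /\ below p (val z.1, val z.2)) (z \in cone p).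
Proof. rewrite /cone finset.in_set; exact: asboolP. Qed.

(* Cells of equal rank form disjoint paths of the forest. *)
Definition rank p := trunc_log 2 #|cone p|.

Lemma in_cone p q : above q -> below p q -> exists2 z : 'I_N * 'I_N, z \in cone p & q = (val z.1, val z.2).
Proof.
move=> aq pq; have [q1 q2] := bndM (above_in aq).
exists (Ordinal q1, Ordinal q2); last by case: q {aq pq} q1 q2.
by apply/coneP; case: q aq pq q1 q2.
Qed.

Lemma cone_gt0 p : above p -> 0 < #|cone p|.
Proof.
move=> ap; have [z zp _] := in_cone ap (below_refl (above_in ap)).
by apply/card_gt0P; exists z.
Qed.

Lemma cone_sub p q : above p -> below p q -> cone q \subset cone p.
Proof.
move=> ap pq; apply/fintype.subsetP => z /coneP[az qz].
by apply/coneP; split=> //; exact: below_trans ap az pq qz.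
Qed.

Lemma rank_le p q : above p -> below p q -> rank q <= rank p.
Proof. by move=> ap pq; apply/leq_trunc_log/subset_leq_card/cone_sub. Qed.

Lemma rank_ub p : rank p <= trunc_log 2 (N * N).
Proof.
apply: leq_trunc_log; apply: leq_trans (max_card _) _.
by rewrite card_prod card_ord.
Qed.

(* Disjoint cones over [p] have total size at most that of [p], so they cannot
   both have its rank. *)
Lemma rank_chain p q r : above p -> above q -> above r -> q.2 <= r.2 ->
  below p q -> below p r -> rank q = rank p -> rank r = rank p -> below q r.
Proof.
move=> ap aq ar le pq pr rq rr.
have [/eqP dis|/finset.set0Pn[z]] := boolP (cone q :&: cone r == finset.set0)%SET; last first.
  rewrite finset.in_setI => /andP[/coneP[_ qz] /coneP[_ rz]].
  exact: below_tree aq ar le qz rz.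
have : #|cone q| + #|cone r| <= #|cone p|.
  rewrite -cardsUI dis cards0 addn0; apply: subset_leq_card.
  by rewrite finset.subUset !cone_sub.
have hq := trunc_logP (isT : 1 < 2) (cone_gt0 aq).
have hr := trunc_logP (isT : 1 < 2) (cone_gt0 ar).
have := trunc_log_ltn #|cone p| (isT : 1 < 2).
rewrite -/(rank _) in hq hr *; rewrite -/(rank p) expnS -rq.
rewrite -/(rank r) rr -rq in hr; rewrite -/(rank q) in hq.
lia.
Qed.

(** One guard serves a whole path: it stands in the row of the lowest run and in the column of a
    cell of the highest. That column meets every run of the path, and [fill] completes the rectangle
    between the guard and the served cell. Guards of equal rank with a common visible cell are
    comparable, which forces their lowest runs to agree. *)
Lemma level_guards : exists g : cell -> cell, exists col : cell -> nat,
  (forall p, above p -> [/\ above (g p), rvis M (g p) p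
     & col p <= trunc_log 2 (N * N)]) /\
  (forall p p' q, above p -> above p' -> rvis M (g p) q -> rvis M (g p') q ->
     col p = col p' -> g p = g p').
Proof.
have /choice[T HT] b : exists t, above b ->
    [/\ above t, below b t, rank t = rank b &
     forall u, above u -> below b u -> rank u = rank b -> u.2 <= t.2].
  have [ab|nab] := pselect (above b); last by exists b.
  have [] := @ex_min _ (fun t => [/\ above t, below b t & rank t = rank b])
    (fun t => N - t.2).
    by exists b; split=> //; apply/below_refl/above_in.
  move=> t [[at_ bt rt] mn]; exists t => _; split=> // u au bu ru.
  have := mn u (And3 au bu ru); have := bndM (above_in au); have := bndM (above_in at_).
  lia.
(* The weight compares rows first and then columns, as these are less than [N]. The tie-break
   singles out one cell of the lowest run, as needed for the final equality [B p = B p']. *)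
have /choice[B HB] p : exists b, above p ->
    [/\ above b, below b p, rank b = rank p &
     forall u, above u -> below u p -> rank u = rank p ->
       b.2 * N + b.1 <= u.2 * N + u.1].
  have [ap|nap] := pselect (above p); last by exists p.
  have [] := @ex_min _ (fun t => [/\ above t, below t p & rank t = rank p])
    (fun t => t.2 * N + t.1).
    by exists p; split=> //; apply/below_refl/above_in.
  move=> t [[at_ bt rt] mn]; exists t => _; split=> // u au bu ru.
  exact: (mn u (And3 au bu ru)).
pose g p : cell := ((T (B p)).1, (B p).2).
have gP p : above p -> [/\ above (g p), rank (g p) = rank p,
    below (g p) (B p) & below (B p) (g p)].
  move=> ap; have [ab bp rb _] := HB p ap; have [aT bT rT _] := HT _ ab.
  have bg : below (B p) (g p).
    by apply: below_row => //; case: bT.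
  have gb : below (g p) (B p).
    by apply: below_row => //=; case: bT => _ h _; exact: hseg_sym.
  (* If column [(T (B p)).1] met [D] only over the row of [B p], then [D] would join the two sides
     of the run of [B p]. *)
  have ag : above (g p).
    have [_ [y [yT Dy vy]]] := aT; have [lT hT vT] := bT.
    have yB : y < (B p).2.
      rewrite ltnNge; apply/negP => le.
      have [nB [z [zB Dz vz]]] := ab.
      apply: (sepM (p := B p) (x := (B p).1) (x' := (T (B p)).1)) => //.
        by apply: hseg_sub hT _ _; rewrite /btw; lia.
      apply: (@conn_trans _ _ ((B p).1, z)).
        apply: vseg_conn => j hj; apply: rows_off => /=; last by move: hj; rewrite /btw; lia.
        by apply: vz; move: hj; rewrite /btw; lia.
      apply: (@conn_trans _ _ ((T (B p)).1, y)).
        by apply: (conn_sub (A := D)) (conD _ _) => // c; exact: D_off.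
      have ne : y <> (B p).2.
        move=> e; rewrite e in Dy; apply: nB; apply: runD Dy _.
        by split=> //; exact: hseg_sym.
      apply: vseg_conn => j hj; apply: rows_off => /=; last by move: hj; rewrite /btw; lia.
      by apply: vT; move: hj; rewrite /btw; lia.
    split.
      by move=> Dg; case: ab => nD _; apply: nD; apply: runD Dg _; split=> //; exact: hseg_sym.
    by exists y; split=> //; apply: vseg_sub vy _ _; rewrite /= /btw; lia.
  split=> //; have := rank_le ab bg; have := rank_le ag gb; lia.
exists g, rank; split=> [p ap|p p' q ap ap' v v' rr].
  have [ag rg gb bg] := gP p ap; split=> //; last exact: rank_ub.
  have [ab bp rb _] := HB p ap; have [aT bT rT mT] := HT _ ab.
  have le := mT p ap bp (esym rb).
  have [_ h1 v1] : below p (T (B p)) by apply: rank_chain bT _ _ => //; rewrite rT rb.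
  have [_ h2 v2] := bT; have [l3 h3 v3] := bp.
  have key a b : hseg M (B p).2 a b -> hseg M p.2 a b ->
      vseg M a (B p).2 p.2 -> vseg M b (B p).2 p.2 -> rvis M (a, (B p).2) (b, p.2).
    move=> ha hb va vb; have [ab'|ba] := leqP a b; first exact: fill.
    move=> i j hi hj; apply: (@fill b a (B p).2 p.2) => //; first exact: ltnW.
    - exact: hseg_sym.
    - exact: hseg_sym.
    - by move: hi; rewrite /btw /=; lia.
  rewrite [X in rvis _ _ X]surjective_pairing; apply: key => //.
  - by apply: hseg_trans (hseg_sym h2) h3.
  - exact: hseg_sym.
  - by apply: vseg_sub v2 _ _; rewrite /btw; lia.
wlog le : p p' ap ap' v v' rr / (g p).2 <= (g p').2.
  move=> W; case: (leqP (g p).2 (g p').2) => [|/ltnW]; first exact: W.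
  by move=> le; symmetry; apply: W le => //.
have [ag rg gb bg] := gP p ap; have [ag' rg' gb' bg'] := gP p' ap'.
have [ab bp rb mb] := HB p ap; have [ab' bp' rb' mb'] := HB p' ap'.
(* [B p] turns out to lie below [B p'], hence below [p'], with the right rank: it competes in the
   minimum that defines [B p']. So both are in the same row, and the roles can be exchanged. *)
have gg' := common_below ag ag' le v v'.
have bb' : below (B p) (B p').
  by apply: below_trans bg _ => //; apply: below_trans gg' gb'.
have h1 := mb' _ ab (below_trans ab ap' bb' bp').
rewrite rb rr in h1; have {}h1 := h1 erefl.
have [lb hb vb] := bb'; have B1 := bndM (above_in ab); have B2 := bndM (above_in ab').
have e2 : (B p).2 = (B p').2 by nia.
have b'b : below (B p') (B p).
  by apply: below_row => //; rewrite -e2; exact: hseg_sym.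
have h2 := mb _ ab' (below_trans ab' ap b'b bp).
rewrite rb' -rr in h2; have {}h2 := h2 erefl.
have e : B p = B p'.
  by rewrite [LHS]surjective_pairing [RHS]surjective_pairing; congr pair; nia.
by rewrite /g e.
Qed.
End Level.

(** * Both sides of a set, by reflection *)

Definition bounded N (M : cell -> Prop) :=
  forall c, M c -> [/\ 0 < c.1, c.1 < N, 0 < c.2 & c.2 < N].

(** On [bounded] sets row indices lie strictly between 0 and [N], so the truncated subtraction is an
    involution that exchanges predecessors and successors. *)
Definition flip N (c : cell) : cell := (c.1, N - c.2).

Lemma hrun_flip N M p c : p.2 <= N -> c.2 <= N ->
  hrun (M \o flip N) p c <-> hrun M (flip N p) (flip N c).
Proof.
case: p c => [p1 p2] [c1 c2] /= hp hc; split=> -[/= e h]; split=> //=; first by rewrite e.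
lia.
Qed.

Lemma rvis_flip N M p q : p.2 <= N -> q.2 <= N ->
  rvis (M \o flip N) p q <-> rvis M (flip N p) (flip N q).
Proof.
move=> hp hq; split=> h i j hi hj.
  have := h i (N - j); rewrite /comp /flip /= (_ : N - (N - j) = j); last first.
    by move: hj; rewrite /flip /btw /=; lia.
  by apply=> //; move: hj; rewrite /flip /btw /=; lia.
by apply: h => //; move: hj; rewrite /flip /btw /=; lia.
Qed.

Lemma bounded_flip N M : bounded N M -> bounded N (M \o flip N).
Proof. by move=> bM c /bM /= [*]; split; lia. Qed.

Lemma flipK N c : c.2 <= N -> flip N (flip N c) = c.
Proof. case: c => a b /= h; rewrite /flip /=; congr pair; lia. Qed.

Lemma conn_flip N (A B : cell -> Prop) a b :
  (forall c, A c -> 0 < c.2 < N) -> (forall c, A c -> B (flip N c)) ->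
  conn A a b -> conn B (flip N a) (flip N b).
Proof.
move=> bA AB; apply: conn_map => // c d /bA hc /bA hd; rewrite /adj /flip /=; lia.
Qed.

Lemma sepH_flip N M : bounded N M -> sepH M -> sepH (M \o flip N).
Proof.
move=> bM sM p x x' hx hx' cn.
have [] := conn_l cn; have [] := conn_r cn.
move=> /bM /= [_ _ h1 h2] _ /bM /= [_ _ h3 h4] _.
apply: (sM (flip N p) x' x) => //=.
have b (c : cell) : off_run (M \o flip N) p c -> 0 < c.2 < N.
  by move=> [/bM /= [? ? ? ?] _]; lia.
have h := @conn_flip N _ (off_run M (flip N p)) _ _ b _ cn.
apply: conn_sym.
have -> : (x, (N - p.2).+1) = flip N (x, p.2.-1) by rewrite /flip /=; congr pair; lia.
have -> : (x', (N - p.2).-1) = flip N (x', p.2.+1) by rewrite /flip /=; congr pair; lia.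
apply: h => c oc; have := b _ oc; case: oc => Mc nr hc; split=> // rc; apply: nr.
by apply/hrun_flip => //; lia.
Qed.

(** The number of possible ranks, 0 included. *)
Definition colours N := (trunc_log 2 (N * N)).+1.

Definition fringe (M D : cell -> Prop) (c : cell) :=
  ~ D c /\ exists2 d, D d & vrun M d c.

(** The two sides of [D] are treated by [level_guards] separately, the second after [flip]. Even
    colours go to one and odd colours to the other, whence the factor 2. *)
Lemma fringe_guards (M D : cell -> Prop) N : sepH M -> bounded N M ->
  (forall c, D c -> M c) -> (forall c d, D c -> hrun M c d -> D d) ->
  (forall c d, D c -> D d -> conn D c d) ->
  exists g : cell -> cell, exists col : cell -> nat,
  (forall p, fringe M D p -> [/\ fringe M D (g p), rvis M (g p) p
     & col p < 2 * colours N]) /\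
  (forall p p' q, fringe M D p -> fringe M D p' -> rvis M (g p) q -> rvis M (g p') q ->
     col p = col p' -> g p = g p').
Proof.
move=> sM bM subD runD conD.
have bM' c : M c -> c.1 < N /\ c.2 < N by move=> /bM [].
have bF := bounded_flip bM.
have bF' c : (M \o flip N) c -> c.1 < N /\ c.2 < N by move=> /bF [].
have [g1 [c1 [g1P c1P]]] := level_guards sM bM' subD runD conD.
have [] := @level_guards (M \o flip N) (D \o flip N) N (sepH_flip bM sM) bF'.
- by move=> c; exact: subD.
- move=> c d Dc hcd; apply: (runD (flip N c)) => //.
  have Mc := subD _ Dc; have Md : (M \o flip N) d.
    by case: hcd => e h; case: d e h => a b /= e; rewrite e; apply; rewrite /btw; lia.
  by apply/hrun_flip => //; [move/bF: Mc => [] | move/bF: Md => []] => *; lia.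
- move=> c d Dc Dd.
  have Mc := subD _ Dc; have Md := subD _ Dd.
  rewrite -(@flipK N c); last by move/bF: Mc => [] *; lia.
  rewrite -(@flipK N d); last by move/bF: Md => [] *; lia.
  apply: conn_flip (conD _ _ Dc Dd); first by move=> e /subD /bM [? ? ? ?]; lia.
  by move=> e De /=; rewrite flipK //; move/subD/bM: De => [] *; lia.
move=> g2 [c2 [g2P c2P]].
have ab1 p : above M D p -> fringe M D p.
  by move=> [nD [y [yp Dy vy]]]; split=> //; exists (p.1, y).
have ab2 p : above (M \o flip N) (D \o flip N) p -> fringe M D (flip N p).
  move=> [nD [y [yp Dy vy]]]; split=> //; exists (flip N (p.1, y)) => //.
  split=> // j hj; have := vy (N - j); rewrite /flip /= in hj *.
  have [_ _ /= ? ?] := bF _ (subD _ Dy : (M \o flip N) _).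
  have -> : N - (N - j) = j by move: hj; rewrite /btw /=; lia.
  by apply; move: hj; rewrite /btw /=; lia.
have ab3 p : fringe M D p -> ~ above M D p -> above (M \o flip N) (D \o flip N) (flip N p).
  move=> [nD [d Dd dp]] na.
  have [e v] := dp.
  have Mp : M p by have := v p.2; rewrite -e -surjective_pairing; apply; rewrite /btw; lia.
  have [_ _ h1 h2] := bM _ Mp.
  have [_ _ h3 h4] := bM _ (subD _ Dd).
  have lt : p.2 < d.2.
    rewrite ltnNge; apply/negP => le; apply: na; split=> //; exists d.2; split.
    - have [ee|] : d.2 = p.2 \/ d.2 < p.2 by lia.
        by case: nD; rewrite [p]surjective_pairing e -ee -surjective_pairing.
      by [].
    - by rewrite e -surjective_pairing.
    - by rewrite e.
  split; first by rewrite /= flipK //; lia.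
  exists (N - d.2); split; first by rewrite /=; lia.
    have -> : ((flip N p).1, N - d.2) = flip N d by rewrite /flip /= e.
    by rewrite /= flipK //; lia.
  move=> j hj; rewrite /flip /= e; apply: v; move: hj; rewrite /flip /btw /=; lia.
pose up p := `[< above M D p >].
exists (fun p => if up p then g1 p else flip N (g2 (flip N p))).
exists (fun p => if up p then (c1 p).*2 else (c2 (flip N p)).*2.+1).
have P2 p : fringe M D p -> ~~ up p -> above (M \o flip N) (D \o flip N) (flip N p).
  by move=> rp /asboolPn; exact: ab3.
have Mring p : fringe M D p -> M p.
  move=> [_ [d _ [e v]]]; have := v p.2; rewrite -e -surjective_pairing; apply.
  by rewrite /btw; lia.
have fl p : fringe M D p -> flip N (flip N p) = p.
  by move=> /Mring /bM [] *; rewrite flipK //; lia.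
have vis p q : (M \o flip N) p -> rvis M (flip N p) q -> q.2 <= N -> rvis (M \o flip N) p (flip N q).
  move=> /bF [_ _ h1 h2] v h; apply/rvis_flip; first lia.
    by rewrite /=; lia.
  by rewrite flipK.
split=> [p rp|p p' q rp rp'].
  case: ifPn => up_p.
    have /asboolP ap := up_p.
    by have [/ab1 ? ? ?] := g1P p ap; split=> //; rewrite /colours; lia.
  have ap := P2 p rp up_p.
  have [h1 h2 h3] := g2P _ ap; split; first exact: ab2.
  - have := h2; rewrite rvis_flip ?fl //.
    + by have /bF[] := above_in h1 => *; lia.
    + by have /bF[] := above_in ap => *; lia.
  - by rewrite /colours; lia.
case: ifPn => u; case: ifPn => u' v v'; rewrite ?(fun_if) //; try lia.
  move/asboolP: u => u; move/asboolP: u' => u' e; apply: c1P v v' _ => //; lia.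
move=> e; have a := P2 _ rp u; have a' := P2 _ rp' u'.
have [h _ _] := g2P _ a; have [h' _ _] := g2P _ a'.
have qN : q.2 <= N.
  have : M q by case: q v {v'} => q1 q2; apply; rewrite /btw /=; lia.
  by move=> /bM [? ? ? ?]; lia.
congr flip; apply: (c2P _ _ (flip N q)) => //; last lia.
- by apply: vis => //; exact: above_in h.
- by apply: vis => //; exact: above_in h'.
Qed.

(** * Layers grown alternately from one run *)

Lemma hrun_in M p c : hrun M p c -> M p /\ M c.
Proof.
case=> e h; split.
  by rewrite [p]surjective_pairing; apply: h; rewrite /btw; lia.
by rewrite [c]surjective_pairing e; apply: h; rewrite /btw; lia.
Qed.

Lemma hrun_swap M p c : hrun (M \o swap) p c <-> vrun M (swap p) (swap c).
Proof. by case: p c => [p1 p2] [c1 c2]; split=> -[/= e h]; split. Qed.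

Lemma vrun_swap M p c : vrun (M \o swap) p c <-> hrun M (swap p) (swap c).
Proof. by case: p c => [p1 p2] [c1 c2]; split=> -[/= e h]; split. Qed.

Lemma rvis_swap M p q : rvis (M \o swap) p q <-> rvis M (swap p) (swap q).
Proof. by split=> h i j hi hj; apply: (h j i). Qed.

Lemma vrun_in M p c : vrun M p c -> M p /\ M c.
Proof.
case=> e h; split.
  by rewrite [p]surjective_pairing; apply: h; rewrite /btw; lia.
by rewrite [c]surjective_pairing e; apply: h; rewrite /btw; lia.
Qed.

Lemma hrun_trans M p q c : hrun M p q -> hrun M q c -> hrun M p c.
Proof.
by case=> e1 h1 [e2 h2]; split; [rewrite e2 | rewrite e1 in h2; exact: hseg_trans h1 h2].
Qed.

Lemma vrun_trans M p q c : vrun M p q -> vrun M q c -> vrun M p c.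
Proof.
case=> e1 h1 [e2 h2]; split; first by rewrite e2.
rewrite e1 in h2 => j hj; have [|] : btw p.2 q.2 j \/ btw q.2 c.2 j.
- by move: hj; rewrite /btw; lia.
- exact: h1.
- exact: h2.
Qed.

Section Layers.
Variables (M : cell -> Prop) (N : nat) (r : cell).
Hypothesis sepM : sepH M.
Hypothesis sepM' : sepH (M \o swap).
Hypothesis bM : bounded N M.
Hypothesis conM : forall c d, M c -> M d -> conn M c d.
Hypothesis Mr : M r.

Definition step k (d c : cell) := if odd k then hrun M d c else vrun M d c.

Fixpoint layer k (c : cell) : Prop :=
  if k is k'.+1 then exists2 d, layer k' d & step k' d c else hrun M r c.

Lemma step_in k d c : step k d c -> M d /\ M c.
Proof. by rewrite /step; case: odd; [exact: hrun_in | exact: vrun_in]. Qed.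

Lemma step_trans k d c e : step k d c -> step k c e -> step k d e.
Proof. by rewrite /step; case: odd; [exact: hrun_trans | exact: vrun_trans]. Qed.

Lemma step_refl k c : M c -> step k c c.
Proof.
rewrite /step => Mc; case: odd; first exact: hrun_refl.
split=> // j hj; have -> : j = c.2 by move: hj; rewrite /btw; lia.
by case: c Mc {hj}.
Qed.

Lemma layer_in k c : layer k c -> M c.
Proof. case: k => [h|k [d _ /step_in[]]] //; by have [] := hrun_in h. Qed.

Lemma layerS k c : layer k c -> layer k.+1 c.
Proof. by move=> h; exists c => //; apply/step_refl/(layer_in h). Qed.

Lemma layer_le k l c : k <= l -> layer k c -> layer l c.
Proof.
elim: l => [|l IH]; first by rewrite leqn0 => /eqP ->.
rewrite leq_eqVlt => /orP[/eqP -> //|kl h]; apply: layerS; exact: IH.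
Qed.

(** [k.+1] has the parity of the step that produced layer [k], or of the initial horizontal run if
    [k = 0]. So a layer is closed under runs in the direction of its last extension, as
    [fringe_guards] requires of [D]. *)
Lemma layer_step k c d : layer k c -> step k.+1 c d -> layer k d.
Proof.
case: k => [h s|k [e he s] s']; first exact: hrun_trans h s.
exists e => //; apply: step_trans s _.
by move: s'; rewrite /step /= negbK.
Qed.

Lemma step_conn k c d (A : cell -> Prop) :
  step k c d -> (forall e, step k c e -> A e) -> conn A c d.
Proof.
case: c d => [c1 c2] [d1 d2]; rewrite /step; case: odd => -[/= e h] hA.
  rewrite e; apply: hseg_conn => i hi; apply: hA; split=> //= j hj; apply: h.
  by move: hi hj; rewrite /btw; lia.
rewrite e; apply: vseg_conn => i hi; apply: hA; split=> //= j hj; apply: h.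
by move: hi hj; rewrite /btw; lia.
Qed.

Lemma layer_conn k c d : layer k c -> layer k d -> conn (layer k) c d.
Proof.
elim: k c d => [|k IH] c d.
  move=> hc hd; apply: (@conn_trans _ _ r).
    apply: conn_sym; exact: (@step_conn 1).
  exact: (@step_conn 1).
move=> [e le sc] [f lf sd].
apply: (@conn_trans _ _ e).
  by apply: conn_sym; apply: step_conn sc _ => u su; exists e.
apply: (@conn_trans _ _ f); last by apply: step_conn sd _ => u su; exists f.
by apply: (conn_sub (A := layer k)) (IH _ _ le lf) => u; exact: layerS.
Qed.

Lemma layer_cover c : M c -> exists k, layer k c.
Proof.
move=> Mc; elim: (conM Mr Mc) => [_|d e rd [k dk] de Me].
  by exists 0; exact: hrun_refl.
have Md := conn_r rd.
have [/eqP e1|e1] := boolP (d.1 == e.1).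
  have v : vrun M d e.
    split=> // j hj; have [->|->] : j = d.2 \/ j = e.2.
    - by move: de hj; rewrite /adj /btw; lia.
    - by rewrite -surjective_pairing.
    - by rewrite e1 -surjective_pairing.
  exists k.+2; case: (boolP (odd k)) => ok.
    by apply: layerS; apply: layerS; apply: (layer_step dk); rewrite /step /= ok.
  by apply: layerS; exists d => //; rewrite /step (negbTE ok).
have v : hrun M d e.
  split=> [|j hj]; first by move: de e1; rewrite /adj; lia.
  have e2 : d.2 = e.2 by move: de e1; rewrite /adj; lia.
  have [->|->] : j = d.1 \/ j = e.1.
  - by move: de hj; rewrite /adj /btw; lia.
  - by rewrite -surjective_pairing.
  - by rewrite e2 -surjective_pairing.
exists k.+2; case: (boolP (odd k)) => ok.
  by apply: layerS; exists d => //; rewrite /step ok.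
by apply: layerS; apply: layerS; apply: (layer_step dk); rewrite /step /= ok.
Qed.

(** A rectangle offers two paths with one turn. The one that begins in the direction under which
    layer [k] is closed leaves the layer only at the turn, and a single step finishes it. *)
Lemma layer_rvis k p q : rvis M p q -> layer k p -> layer k.+1 q.
Proof.
move=> v lp; rewrite /=.
case: (boolP (odd k)) => ok.
  exists (p.1, q.2); last first.
    by rewrite /step ok; split=> // i hi; apply: v; move: hi; rewrite /btw /=; lia.
  apply: (layer_step lp); rewrite /step /= ok; split=> // j hj.
  by apply: v; move: hj; rewrite /btw /=; lia.
exists (q.1, p.2); last first.
  by rewrite /step (negbTE ok); split=> // i hi; apply: v; move: hi; rewrite /btw /=; lia.
apply: (layer_step lp); rewrite /step /= ok; split=> // j hj.
by apply: v; move: hj; rewrite /btw /=; lia.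
Qed.

Definition layer_fringe k c := layer k.+1 c /\ ~ layer k c.

(** For odd [k] the step is horizontal and [fringe_guards] is applied to the transposed cells; this
    is where [sepM'] enters. *)
Lemma ringk_guards k : exists gc : (cell -> cell) * (cell -> nat),
  (forall p, layer_fringe k p -> [/\ layer_fringe k (gc.1 p), rvis M (gc.1 p) p
     & gc.2 p < 2 * colours N]) /\
  (forall p p' q, layer_fringe k p -> layer_fringe k p' -> rvis M (gc.1 p) q -> rvis M (gc.1 p') q ->
     gc.2 p = gc.2 p' -> gc.1 p = gc.1 p').
Proof.
case: (boolP (odd k)) => ok; last first.
  have [|||g [c [h1 h2]]] := @fringe_guards M (layer k) N sepM bM.
  - exact: layer_in.
  - by move=> c d lc s; apply: layer_step lc _; rewrite /step /= ok.
  - exact: layer_conn.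
  have E p : fringe M (layer k) p <-> layer_fringe k p.
    split=> [[n [d ld s]]|[[d ld s] n]]; split=> //; exists d => //.
      by rewrite /step (negbTE ok).
    by rewrite /step (negbTE ok) in s.
  exists (g, c); split=> [p /E /h1[/E]|p p' q /E rp /E rp'] //; exact: h2.
have bM' : bounded N (M \o swap) by move=> c /bM[].
have [|||g [c [h1 h2]]] := @fringe_guards (M \o swap) (layer k \o swap) N sepM' bM'.
- by move=> c; exact: layer_in.
- by move=> c d lc /hrun_swap s; apply: layer_step lc _; rewrite /step /= ok.
- move=> [c1 c2] [d1 d2] lc ld; have := layer_conn lc ld.
  move/(@conn_map _ (layer k \o swap) swap); apply; first by case.
  by move=> a b _ _; rewrite /adj /=; lia.
have sK c' : swap (swap c') = c' by case: c'.
have E p : fringe (M \o swap) (layer k \o swap) p <-> layer_fringe k (swap p).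
  split=> [[n [d ld /vrun_swap s]]|[[d ld s] n]]; split=> //.
    by exists (swap d) => //; rewrite /step ok.
  exists (swap d); first by rewrite /= sK.
  by apply/vrun_swap; rewrite sK; move: s; rewrite /step ok.
exists (swap \o g \o swap, c \o swap); split=> [p|p p' q].
  rewrite -{1}(sK p) => /E /h1[/E r1 /rvis_swap r2 r3]; rewrite sK in r2; split=> //.
rewrite -{1}(sK p) -{1}(sK p') => /E rp /E rp' /= v v' e; congr swap.
by apply: (h2 _ _ (swap q)) => //; apply/rvis_swap; rewrite sK.
Qed.

(** A guard has the same level as the cell it serves. Guards with a common visible cell have levels
    that differ by at most two, so the residue modulo 3 determines the level, and inside one level
    [ringk_guards] applies. *)
Lemma layered_guards : exists g : cell -> cell, exists col : cell -> nat,
  (forall p, M p -> [/\ M (g p), rvis M (g p) p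
     & col p < 6 * colours N + 1]) /\
  (forall p p' q, M p -> M p' -> rvis M (g p) q -> rvis M (g p') q ->
     col p = col p' -> g p = g p').
Proof.
have /choice[lev levP] p : exists k, M p -> layer k p /\ forall l, layer l p -> k <= l.
  have [Mp|nMp] := pselect (M p); last by exists 0.
  have [k [lk mk]] := @ex_min _ (fun k => layer k p) id (layer_cover Mp).
  by exists k.
have /choice[gc gcP] := ringk_guards.
have ringP p : M p -> lev p <> 0 -> layer_fringe (lev p).-1 p.
  move=> Mp; case: (levP p Mp); case: (lev p) => // k lk mk _; split=> // /mk /=; lia.
exists (fun p => if lev p == 0 then r else (gc (lev p).-1).1 p).
(* The residue is the last digit in base 3, and the successor frees colour 0 for [r]. *)
exists (fun p => if lev p == 0 then 0 else ((gc (lev p).-1).2 p * 3 + lev p %% 3).+1).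
split=> [p Mp|p p' q Mp Mp'].
  have [l0 _] := levP p Mp.
  case: eqP => [e|ne].
    rewrite e in l0; split=> // i j hi hj.
    have [e2 h2] := l0; have -> : j = r.2 by move: hj; rewrite e2 /btw; lia.
    exact: h2.
  have [[h1 h2] h3 h4] := (gcP (lev p).-1).1 p (ringP p Mp ne); split=> //.
    exact: layer_in h1.
  move: h4; set x := (gc _).2 p; have : lev p %% 3 < 3 by rewrite ltn_mod.
  lia.
case: eqP => [e|ne]; case: eqP => [e'|ne'] //.
set g := (gc _).1 p; set g' := (gc _).1 p' => v v' ec.
have [[h1 h2] _ c1] := (gcP (lev p).-1).1 p (ringP p Mp ne).
have [[h1' h2'] _ c1'] := (gcP (lev p').-1).1 p' (ringP p' Mp' ne').
rewrite -/g -/g' in h1 h2 h1' h2'.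
have rvsym a b : rvis M a b -> rvis M b a.
  by move=> h i j hi hj; apply: h; move: hi hj; rewrite /btw; lia.
have near a b s t : rvis M a q -> rvis M b q -> ~ layer s a -> layer t b -> s <= t.+1.
  move=> va vb na lb; rewrite leqNgt; apply/negP => lt; apply: na.
  apply: (layer_le lt); apply: layer_rvis (rvsym _ _ va) _; exact: layer_rvis vb _.
have n1 := near _ _ _ _ v v' h2 h1'; have n2 := near _ _ _ _ v' v h2' h1.
have m1 := ltn_mod (lev p) 3; have m2 := ltn_mod (lev p') 3.
have em : lev p = lev p' %[mod 3] by lia.
have el : lev p = lev p' by lia.
rewrite /g /g' -el in ec v v' *.
apply: (gcP (lev p).-1).2 v v' _; last lia.
- exact: ringP.
- by rewrite el; apply: ringP.
Qed.
End Layers.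

(** * Runs separate *)

Definition spans (a b j : nat) : bool := (a < j < b) || (b < j < a).

(* Cells with two odd coordinates are grid points, those with one are open unit
   edges, and those with none are open faces. *)
Record grid_chain (n : nat) (c : nat -> cell) (M : cell -> Prop) : Prop := GridChain {
  gc_odd : forall k, odd (c k).1 && odd (c k).2;
  gc_axis : forall k, (c k).1 = (c k.+1).1 \/ (c k).2 = (c k.+1).2;
  gc_closeH : forall i j, M (i, j) -> ~~ odd i -> M (i.-1, j) /\ M (i.+1, j);
  gc_closeV : forall i j, M (i, j) -> ~~ odd j -> M (i, j.-1) /\ M (i, j.+1);
  gc_nearH : forall i j, M (i, j) -> odd i -> M (i.-1, j) \/ M (i.+1, j);
  gc_nearV : forall i j, M (i, j) -> odd j -> M (i, j.-1) \/ M (i, j.+1);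
  gc_edgeV : forall k i j, k < n -> (c k).1 = i -> (c k.+1).1 = i ->
    spans (c k).2 (c k.+1).2 j -> ~~ odd j -> M (i.-1, j) -> M (i.+1, j) -> False;
  gc_edgeH : forall k i j, k < n -> (c k).2 = j -> (c k.+1).2 = j ->
    spans (c k).1 (c k.+1).1 i -> ~~ odd i -> M (i, j.-1) -> M (i, j.+1) -> False;
  gc_bdV : forall i j, odd i -> ~~ odd j -> M (i, j) -> ~ (M (i.-1, j) /\ M (i.+1, j)) ->
    exists k, [/\ k < n, (c k).1 = i, (c k.+1).1 = i & spans (c k).2 (c k.+1).2 j];
  gc_bdH : forall i j, ~~ odd i -> odd j -> M (i, j) -> ~ (M (i, j.-1) /\ M (i, j.+1)) ->
    exists k, [/\ k < n, (c k).2 = j, (c k.+1).2 = j & spans (c k).1 (c k.+1).1 i];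
  gc_pinch : forall i j, odd i -> odd j -> M (i.-1, j.-1) -> M (i.+1, j.+1) ->
    M (i.-1, j.+1) \/ M (i.+1, j.-1);
  gc_pinch' : forall i j, odd i -> odd j -> M (i.-1, j.+1) -> M (i.+1, j.-1) ->
    M (i.-1, j.-1) \/ M (i.+1, j.+1)
}.

Lemma grid_chain_swap n c M :
  grid_chain n c M -> grid_chain n (swap \o c) (M \o swap).
Proof.
case=> h1 h2 h3 h4 h5 h6 h7 h8 h9 h10 h11 h12; split=> //=.
- by move=> k; rewrite andbC.
- by move=> k; case: (h2 k); [right | left].
- by move=> i j; exact: h4.
- by move=> i j; exact: h3.
- by move=> i j; exact: h6.
- by move=> i j; exact: h5.
- by move=> k i j; exact: h8.
- by move=> k i j; exact: h7.
- by move=> i j oi oj; exact: h10.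
- by move=> i j oi oj; exact: h9.
- by move=> i j oi oj Ma Mb; case: (h11 j i); auto.
- by move=> i j oi oj Ma Mb; case: (h12 j i); auto.
Qed.

Lemma big_addb_telescope (f : nat -> bool) m n : m <= n ->
  \big[addb/false]_(m <= k < n) (f k (+) f k.+1) = f m (+) f n.
Proof.
move=> mn; rewrite -(subnK mn); elim: (n - m) => [|d IH].
  by rewrite add0n big_geq // addbb.
rewrite addSn big_nat_recr ?IH /=; last by rewrite leq_addl.
by rewrite -!addbA; congr addb; rewrite addbA addbb.
Qed.

(** * Crossing parity for a boundary arc closed by a run *)

Section Parity.
Variables (n : nat) (c : nat -> cell) (M : cell -> Prop).
Hypothesis gc : grid_chain n c M.
Variables (ka kb p q l r j0 : nat).
Hypothesis kab : ka < kb < n.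
Hypothesis ej0 : ~~ odd j0.
Hypothesis pq : p = l /\ q = r \/ p = r /\ q = l.
Hypothesis lr : l < r.
Hypothesis run : forall x, l <= x <= r -> M (x, j0).
Hypothesis maxl : ~ M (l.-1, j0).
Hypothesis maxr : ~ M (r.+1, j0).
Hypothesis oddl : odd l.
Hypothesis oddr : odd r.
Hypothesis edgea : [/\ (c ka).1 = p, (c ka.+1).1 = p & spans (c ka).2 (c ka.+1).2 j0].
Hypothesis edgeb : [/\ (c kb).1 = q, (c kb.+1).1 = q & spans (c kb).2 (c kb.+1).2 j0].

(* The closed curve made of the run in row [j0] and of one of the two boundary
   arcs that it cuts off. *)
Definition arc k : cell :=
  if k == ka then (p, j0) else if k == kb.+1 then (q, j0) else c k.

(* Parity of the number of edges of that curve to the left of the point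
   (a + 1/2, b + 1/2). *)
Definition parity a b : bool := \big[addb/false]_(ka <= k < kb.+1)
  (((arc k).1 <= a) && (((arc k).2 <= b) (+) ((arc k.+1).2 <= b))).

(* The point (a + 1/2, b + 1/2) lies in the face [(ev a, ev b)]. *)
Definition ev a := if odd a then a.+1 else a.

Lemma arcE k : ka < k <= kb -> arc k = c k.
Proof. by move=> h; rewrite /arc; case: eqP => [|_]; [lia | case: eqP => //; lia]. Qed.

Lemma arc_a : arc ka = (p, j0).
Proof. by rewrite /arc eqxx. Qed.

Lemma arc_b : arc kb.+1 = (q, j0).
Proof. by rewrite /arc eqxx; case: eqP => //; lia. Qed.

(** A counted edge changes height, hence is vertical. The first and last edges of the arc are
    pieces, cut at row [j0], of edges of the chain, and what a piece crosses the whole edge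
    crosses. *)
Lemma arc_edge k b : ka <= k <= kb ->
  ((arc k).2 <= b) (+) ((arc k.+1).2 <= b) ->
  [/\ odd (arc k).1, (c k).1 = (arc k).1, (c k.+1).1 = (arc k).1 & spans (c k).2 (c k.+1).2 (ev b)].
Proof.
move=> hk; have := gc_odd gc k; have := gc_odd gc k.+1; have := gc_axis gc k.
case: edgea edgeb => a1 a2 a3 [b1 b2 b3]; move: a3 b3 ej0; rewrite /spans /ev.
have [->|[->|hk']] : k = ka \/ (k = kb \/ ka < k < kb) by lia.
- rewrite arc_a arcE; last lia.
  move=> /=; case: (boolP (odd b)); split; lia.
- rewrite arc_b arcE; last lia.
  move=> /=; case: (boolP (odd b)); split; lia.
rewrite !arcE; [|lia|lia].
case: (boolP (odd b)); split; lia.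
Qed.

(** A change would come from a vertical edge in column [i] between two faces of [M], which
    [gc_edgeV] excludes. *)
Lemma parity_hmove i b : 0 < i -> M (ev i.-1, ev b) -> M (ev i, ev b) ->
  parity i b = parity i.-1 b.
Proof.
move=> i0 M1 M2; rewrite /parity; apply: eq_big_nat => k hk.
have [h|] := boolP (_ (+) _); last by rewrite !andbF.
have hk' : ka <= k <= kb by lia.
have [od1 e1 e2 sp] := arc_edge hk' h.
congr andb; have [e|ne] := eqVneq (arc k).1 i; last lia.
exfalso; rewrite e in od1 e1 e2.
apply: (gc_edgeV gc (k := k) (i := i)) sp _ _ _ => //; first lia.
- by rewrite /ev; case: ifP => /= ->.
- by move: M1; rewrite /ev (_ : odd i.-1 = false) //; lia.
- by move: M2; rewrite /ev od1.
Qed.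

(** The vertices at height [j] to the left of the point telescope along the arc, up to horizontal
    edges at height [j] that pass the point; [gc_edgeH] excludes these, as both faces are in [M].
    Only the two ends of the arc remain, so vertically the parity changes exactly across the run. *)
Lemma parity_vmove a j : 0 < j -> M (ev a, ev j.-1) -> M (ev a, ev j) ->
  parity a j (+) parity a j.-1 = (j == j0) && (l <= a < r).
Proof.
move=> lj M1 M2.
have T := @big_addb_telescope
  (fun k => ((arc k).1 <= a) && ((arc k).2 == j)) ka kb.+1.
have -> : (j == j0) && (l <= a < r) =
    \big[addb/false]_(ka <= k < kb.+1)
      ((((arc k).1 <= a) && ((arc k).2 == j)) (+)
       (((arc k.+1).1 <= a) && ((arc k.+1).2 == j))).
  rewrite T; last lia.
  by rewrite arc_a arc_b /= (eq_sym j); case: (j0 == j); rewrite ?andbF ?andbT //; lia.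
rewrite /parity -big_split; apply: eq_big_nat => k hk.
have e1 x : (x <= j) (+) (x <= j.-1) = (x == j) by lia.
rewrite /= -andb_addr.
have -> : (((arc k).2 <= j) (+) ((arc k.+1).2 <= j)) (+) (((arc k).2 <= j.-1) (+) ((arc k.+1).2 <= j.-1))
   = ((arc k).2 == j) (+) ((arc k.+1).2 == j).
  by rewrite -!e1; case: (_ <= j); case: (_ <= j.-1); case: (_ <= j); case: (_ <= j.-1).
have [e|ne] := eqVneq ((arc k).1 <= a) ((arc k.+1).1 <= a).
  by rewrite -e; case: (_ <= a).
have [e2|] := eqVneq (arc k.+1).2 j; last first.
  by rewrite andbF !addbF.
exfalso.
have := gc_odd gc k; have := gc_odd gc k.+1; have := gc_axis gc k.
case: edgea edgeb => a1 a2 a3 [b1 b2 b3].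
have [ek|[ek|hk']] : k = ka \/ (k = kb \/ ka < k < kb) by lia.
- move: ne; rewrite ek arc_a arcE; last lia.
  by rewrite /= a2 eqxx.
- by move: ne; rewrite ek arc_b arcE /=; [rewrite b1 eqxx | lia].
move: ne e2; rewrite !arcE; [|lia|lia] => ne e2 ax o1 o2.
have e3 : (c k).2 = j by move: ne; case: ax => [->|]; [rewrite eqxx | lia].
have oj : odd j by rewrite -e3; lia.
apply: (gc_edgeH gc (k := k) (i := ev a)) e3 e2 _ _ _ _ => //; first lia.
- by move: ne o1 o2; clear; rewrite /spans /ev; case: (boolP (odd a)) => oa; lia.
- by rewrite /ev; case: ifP => /= ->.
- by move: M1; rewrite {2}/ev (_ : odd j.-1 = false) //; lia.
- by move: M2; rewrite {2}/ev oj.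
Qed.

Lemma ev_pred i : ~~ odd i -> 0 < i -> ev i.-1 = ev i.
Proof. by move=> oi i0; rewrite /ev; case: (boolP (odd i.-1)); case: (boolP (odd i)) => //; lia. Qed.

(** The four sample points are those around the cell [(i, j)]. Two in diagonal position are compared
    through a third whose face is in [M]; the pinch conditions supply it. *)
Lemma corner_eq i j a b a' b' : 0 < i -> 0 < j -> M (i, j) ->
  ~ (j = j0 /\ l <= i <= r) ->
  i.-1 <= a <= i -> j.-1 <= b <= j -> i.-1 <= a' <= i -> j.-1 <= b' <= j ->
  M (ev a, ev b) -> M (ev a', ev b') -> parity a b = parity a' b'.
Proof.
move=> i0 lj Mij off.
have H x : M (ev i.-1, ev x) -> M (ev i, ev x) -> parity i x = parity i.-1 x.
  exact: parity_hmove.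
have V x : i.-1 <= x <= i -> M (ev x, ev j.-1) -> M (ev x, ev j) -> parity x j = parity x j.-1.
  move=> hx M1 M2; have := parity_vmove lj M1 M2.
  have -> : (j == j0) && (l <= x < r) = false by apply/negP => h; apply: off; lia.
  by case: parity; case: parity.
have hi : i.-1 <= i <= i by lia.
have hi' : i.-1 <= i.-1 <= i by lia.
have E1 : ~~ odd i -> ev i.-1 = ev i by move=> h; exact: ev_pred.
have E2 : ~~ odd j -> ev j.-1 = ev j by move=> h; exact: ev_pred.
have O1 : odd i -> ev i.-1 = i.-1 /\ ev i = i.+1.
  by move=> h; rewrite /ev h (_ : odd i.-1 = false) //; lia.
have O2 : odd j -> ev j.-1 = j.-1 /\ ev j = j.+1.
  by move=> h; rewrite /ev h (_ : odd j.-1 = false) //; lia.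
have D1 : M (ev i.-1, ev j.-1) -> M (ev i, ev j) -> parity i j = parity i.-1 j.-1.
  move=> M1 M2.
  have [M3|M3] : M (ev i.-1, ev j) \/ M (ev i, ev j.-1).
    have [oi|/E1 e] := boolP (odd i); last by left; rewrite e.
    have [oj|/E2 e] := boolP (odd j); last by left; rewrite -e.
    move: M1 M2; have [-> ->] := O1 oi; have [-> ->] := O2 oj; exact: (gc_pinch gc oi oj).
  - by rewrite (H _ M3 M2) (V _ hi' M1 M3).
  - by rewrite (V _ hi M3 M2) (H _ M1 M3).
have D2 : M (ev i.-1, ev j) -> M (ev i, ev j.-1) -> parity i.-1 j = parity i j.-1.
  move=> M1 M2.
  have [M3|M3] : M (ev i.-1, ev j.-1) \/ M (ev i, ev j).
    have [oi|/E1 e] := boolP (odd i); last by right; rewrite -e.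
    have [oj|/E2 e] := boolP (odd j); last by right; rewrite -e.
    move: M1 M2; have [-> ->] := O1 oi; have [-> ->] := O2 oj; exact: (gc_pinch' gc oi oj).
  - by rewrite (H _ M3 M2) (V _ hi' M3 M1).
  - by rewrite -(H _ M1 M3) (V _ hi M2 M3).
move=> ha hb ha' hb'.
have [->|->] : a = i \/ a = i.-1 by clear -ha; lia.
all: have [->|->] : b = j \/ b = j.-1 by clear -hb; lia.
all: have [->|->] : a' = i \/ a' = i.-1 by clear -ha'; lia.
all: have [->|->] : b' = j \/ b' = j.-1 by clear -hb'; lia.
all: move=> M1 M2.
all: by [| rewrite H | rewrite -H | rewrite V | rewrite -V
  | rewrite D1 | rewrite -D1 | rewrite D2 | rewrite -D2].
Qed.

(** Of two adjacent cells one is even in the coordinate where they differ; from it [gc_nearH] or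
    [gc_nearV] leads to a face of [M] touching both. This carries the parity from one cell of a path
    to the next. *)
Lemma adj_corner c1 c2 : adj c1 c2 -> M c1 -> M c2 ->
  exists a b, [/\ M (ev a, ev b), c1.1.-1 <= a <= c1.1, c1.2.-1 <= b <= c1.2,
     c2.1.-1 <= a <= c2.1 & c2.2.-1 <= b <= c2.2].
Proof.
have nV i j : M (i, j) -> exists2 b, M (i, ev b) & j.-1 <= b <= j.
  move=> Mij; have [oj|ej] := boolP (odd j).
    case: (gc_nearV gc Mij oj) => h; [exists j.-1; last lia | exists j; last lia].
      by rewrite /ev (_ : odd j.-1 = false) //; lia.
    by rewrite /ev oj.
  by exists j; [rewrite /ev (negbTE ej) | lia].
have nH i j : M (i, j) -> exists2 b, M (ev b, j) & i.-1 <= b <= i.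
  move=> Mij; have [oj|ej] := boolP (odd i).
    case: (gc_nearH gc Mij oj) => h; [exists i.-1; last lia | exists i; last lia].
      by rewrite /ev (_ : odd i.-1 = false) //; lia.
    by rewrite /ev oj.
  by exists i; [rewrite /ev (negbTE ej) | lia].
have evc i (A : nat -> Prop) : A i -> A i.+1 -> A (ev i) by rewrite /ev; case: odd.
have evd i : ~~ odd (ev i) by rewrite /ev; case: ifP => /= ->.
case: c1 c2 => [i j] [i' j']; rewrite /adj /= => h M1 M2.
have [[e1 e2]|[[e1 e2]|[[e1 e2]|[e1 e2]]]] : (j' = j /\ i' = i.+1) \/ ((j' = j /\ i = i'.+1) \/
   ((i' = i /\ j' = j.+1) \/ (i' = i /\ j = j'.+1))) by lia.
- rewrite {}e1 {}e2 in h M2 *.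
  have /nV[b Mb hb] : M (ev i, j) by apply: (evc i (fun x => M (x, j))).
  by exists i, b; split=> //; lia.
- rewrite {}e1 {}e2 in h M1 M2 *.
  have /nV[b Mb hb] : M (ev i', j) by apply: (evc i' (fun x => M (x, j))).
  by exists i', b; split=> //; lia.
- rewrite {}e1 {}e2 in h M2 *.
  have /nH[b Mb hb] : M (i, ev j) by apply: (evc j (fun x => M (i, x))).
  by exists b, j; split=> //; lia.
- rewrite {}e1 {}e2 in h M1 M2 *.
  have /nH[b Mb hb] : M (i, ev j') by apply: (evc j' (fun x => M (i, x))).
  by exists b, j'; split=> //; lia.
Qed.

Definition off_row (z : cell) := M z /\ ~ (z.2 = j0 /\ l <= z.1 <= r).

Lemma parity_conn z z' a b a' b' : (forall c, M c -> 0 < c.1 /\ 0 < c.2) ->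
  conn off_row z z' ->
  z.1.-1 <= a <= z.1 -> z.2.-1 <= b <= z.2 ->
  z'.1.-1 <= a' <= z'.1 -> z'.2.-1 <= b' <= z'.2 ->
  M (ev a, ev b) -> M (ev a', ev b') -> parity a b = parity a' b'.
Proof.
move=> pos cn ha hb ha' hb' Mab; elim: cn a' b' ha' hb' => [[Mz oz]|d e zd IH de [Me oe]] a' b' ha' hb' Mab'.
  have [? ?] := pos _ Mz.
  by apply: (@corner_eq z.1 z.2) => //; rewrite -surjective_pairing.
have [Md od] := conn_r zd.
have [x [y [Mxy hx hy hx' hy']]] := adj_corner de Md Me.
rewrite (IH x y) //; have [? ?] := pos _ Me.
by apply: (@corner_eq e.1 e.2) => //; rewrite -surjective_pairing.
Qed.

(** A path off the run would give equal parities under and over it, whereas crossing the run flips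
    the parity. Since [j0] is even, both sample heights lie in the face row [j0], which the run cuts
    in two. *)
Lemma parity_sep x x' : (forall c, M c -> 0 < c.1 /\ 0 < c.2) ->
  l <= x <= r -> l <= x' <= r -> ~ conn off_row (x, j0.-1) (x', j0.+1).
Proof.
move=> pos hx hx' cn.
have j00 : 0 < j0 by have [] := pos _ (run hx).
have evj : ev j0.-1 = j0 by rewrite /ev (_ : odd j0.-1) ; lia.
have evj0 : ev j0 = j0 by rewrite /ev (negbTE ej0).
have Mev a : l <= a < r -> M (ev a, j0) by move=> h; apply: run; rewrite /ev; case: odd; lia.
have cst a a' : l <= a <= a' -> a' < r -> parity a' j0.-1 = parity a j0.-1.
  elim: a' => [|a' IH] h1 h2; first by have -> : a = 0 by lia.
  have [->//|h] : a = a'.+1 \/ a <= a' by lia.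
  by rewrite parity_hmove //= ?IH // ?evj; [lia | lia | apply: Mev; lia | apply: Mev; lia].
(* The sample points along the run have [l <= a < r]; at its right end the one to the left is
   taken. *)
pose a := if x < r then x else r.-1; pose a' := if x' < r then x' else r.-1.
have ha : l <= a < r /\ x.-1 <= a <= x by rewrite /a; case: ifP; lia.
have ha' : l <= a' < r /\ x'.-1 <= a' <= x' by rewrite /a'; case: ifP; lia.
have e1 := parity_conn (a := a) (b := j0.-1) (a' := a') (b' := j0) pos cn.
rewrite /= evj evj0 in e1.
have {}e1 : parity a j0.-1 = parity a' j0.
  by apply: e1; try lia; apply: Mev; lia.
have e2 : parity a j0.-1 = parity a' j0.-1.
  by case: (leqP a a') => h; [symmetry|]; apply: cst; lia.
have := @parity_vmove a' j0 j00; rewrite evj evj0 eqxx -e1 -e2 addbb.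
move=> /(_ (Mev _ _) (Mev _ _)) h; have := h; lia.
Qed.

End Parity.

(** * Separation by maximal runs in rows of either parity *)

Section Separation.
Variables (n N : nat) (c : nat -> cell) (M : cell -> Prop).
Hypothesis gc : grid_chain n c M.
Hypothesis bM : bounded N M.

Lemma max_run x j : M (x, j) -> exists l r, [/\ l <= x <= r,
  forall i, l <= i <= r -> M (i, j), ~ M (l.-1, j) & ~ M (r.+1, j)].
Proof.
move=> Mx.
have [] := @ex_min _ (fun l => l <= x /\ forall i, l <= i <= x -> M (i, j)) id.
  by exists x; split=> // i hi; have -> : i = x by lia.
move=> l [[lx hl] ml].
have [] := @ex_min _ (fun r => x <= r < N /\ forall i, x <= i <= r -> M (i, j)) (fun r => N - r).
  have [_ /= ? _ _] := bM Mx.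
  by exists x; split; [lia | move=> i hi; have -> : i = x by lia].
move=> r [[xr hr] mr]; exists l, r; split; first lia.
- by move=> i hi; case: (leqP i x) => h; [apply: hl | apply: hr]; lia.
- have [/= ? _ _ _] : [/\ 0 < l, l < N, 0 < j & j < N] by apply: (bM (hl l _)); lia.
  move=> Ml; suff : l <= l.-1 by lia.
  apply: ml; split; first lia.
  move=> i hi; have [->//|h] : i = l.-1 \/ l <= i by lia.
  by apply: hl; lia.
move=> Mr; have [_ /= ? _ _] := bM Mr.
suff : N - r <= N - r.+1 by lia.
apply: mr; split; first lia.
move=> i hi; have [->//|h] : i = r.+1 \/ i <= r by lia.
by apply: hr; lia.
Qed.

(** A maximal run in a gap row begins and ends on vertical boundary edges, by [gc_closeH] and
    [gc_bdV]. The order of these edges in the chain decides at which end of the run the arc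
    starts. *)
Lemma sep_even p x x' : ~~ odd p.2 -> M p ->
  hseg M p.2 p.1 x -> hseg M p.2 p.1 x' ->
  ~ conn (off_run M p) (x, p.2.-1) (x', p.2.+1).
Proof.
case: p => x0 j0 /= ej Mp hx hx' cn.
have [l [r [hlr run ml mr]]] := max_run Mp.
have inr y : hseg M j0 x0 y -> l <= y <= r.
  move=> h; rewrite -[_ && _]negbK; apply/negP => ny.
  have [h1|h1] : y < l \/ r < y by lia.
    by apply: ml; apply: h; rewrite /btw; lia.
  by apply: mr; apply: h; rewrite /btw; lia.
have Ml : M (l, j0) by apply: run; lia.
have Mr : M (r, j0) by apply: run; lia.
have ol : odd l by rewrite -[odd l]negbK; apply/negP => ol; have [] := gc_closeH gc Ml ol.
have or : odd r by rewrite -[odd r]negbK; apply/negP => er; have [] := gc_closeH gc Mr er.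
have lr : l < r.
  rewrite ltnNge; apply/negP => h; have e : r = l by lia.
  by rewrite e in mr; case: (gc_nearH gc Ml ol).
have [|k1 [n1 a1 b1 s1]] := gc_bdV gc ol ej Ml; first by case.
have [|k2 [n2 a2 b2 s2]] := gc_bdV gc or ej Mr; first by case.
have pos d : M d -> 0 < d.1 /\ 0 < d.2 by move=> /bM [].
have cn' : conn (off_row M l r j0) (x, j0.-1) (x', j0.+1).
  apply: conn_sub cn => -[z1 z2] [Mz nz]; split=> // -[/= e hz]; apply: nz; split=> //= i hi.
  by apply: run; move: hi; rewrite /btw; lia.
have [lt|gt] := ltnP k1 k2.
  by apply: (@parity_sep n c M gc k1 k2 l r l r j0) cn'; rewrite ?lt ?n2; auto.
have {}gt : k2 < k1.
  by rewrite ltn_neqAle gt andbT; apply/eqP => e; move: a2; rewrite e a1; lia.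
by apply: (@parity_sep n c M gc k2 k1 r l l r j0) cn'; rewrite ?gt ?n1; auto.
Qed.

(* In an odd row, the part of the path after its last visit to the run just
   above links the two sides of that run. *)
Lemma grid_chain_sepH : sepH M.
Proof.
move=> p x x' hx hx' cn.
have [Mx' _] := conn_r cn; have [Mx _] := conn_l cn.
have Mp : M p by rewrite [p]surjective_pairing; apply: hx; rewrite /btw; lia.
have [op|ep] := boolP (odd p.2); last exact: (sep_even ep Mp hx hx').
pose p' : cell := (x', p.2.+1).
have H d : conn (off_run M p) p' d -> hrun M p' d \/
    exists2 y, hseg M p.2.+1 x' y & conn (off_run M p') (y, p.2.+2) d.
  move=> cd; elim: {d} cd => [_|d e pd IH de [Me ne]]; first by left; exact: hrun_refl.
  have [he|he] := pselect (hrun M p' e); [by left | right].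
  case: IH => [hd|[y hy cy]]; last by exists y => //; apply: conn_step cy de _.
  exists d.1; first by case: hd.
  case: hd => /= ed hd.
  have ed' : e = (e.1, e.2) by case: (e).
  have [[e1 e2]|[[e1 e2]|[e2 e1]]] : (e.1 = d.1 /\ e.2 = p.2.+2) \/
      ((e.1 = d.1 /\ e.2 = p.2) \/ (e.2 = p.2.+1 /\ (e.1 = d.1.+1 \/ d.1 = e.1.+1))).
  - by move: de; rewrite /adj ed; lia.
  - rewrite -e1 -e2 -ed'; apply: conn_refl; split=> //; case=> /=; lia.
  - case: ne; split=> //=; apply: hseg_trans hx' _ => i hi; rewrite e1 in hi.
    have ep1 : ~~ odd p.2.+1 by rewrite /= op.
    by have [] := gc_closeV gc (hd i hi) ep1.
  - case: he; split=> //= i hi; have [|->] : btw x' d.1 i \/ i = e.1.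
    + by move: hi; rewrite /btw; lia.
    + exact: hd.
    + by rewrite -e2 -ed'.
have [[/=]|[y hy cy]] := H _ (conn_sym cn); first lia.
apply: (@sep_even p' x' y) => //=; [by rewrite op | by move=> i hi; have -> : i = x' by move: hi; rewrite /btw; lia |].
have off' i : hseg M p.2 p.1 i -> off_run M p' (i, p.2).
  by move=> h; split; [apply: h; rewrite /btw; lia | case=> /=; lia].
apply: conn_sym; apply: conn_trans cy _; apply: (@conn_trans _ _ (x, p.2)).
  apply: (@conn_step _ _ (x, p.2.-1)); [|rewrite /adj /=; have := bM Mx => -[]; lia | exact: off'].
  by apply: conn_refl; split=> // -[/=]; lia.
apply: hseg_conn => i hi; apply: off'; have [h|h] : btw p.1 x i \/ btw p.1 x' i.
- by move: hi; rewrite /btw; lia.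
- by apply: hseg_sub hx _ _; move: h; rewrite /btw; lia.
- by apply: hseg_sub hx' _ _; move: h; rewrite /btw; lia.
Qed.

End Separation.

End Cells.

Local Open Scope classical_set_scope.
Local Open Scope ring_scope.

(** * From polygons to cells *)

Section Coord.
Variables (R : realFieldType) (s : seq R).
Hypothesis sorted_s : sorted <%R s.

(* Odd values are the elements of [s], even values the gaps between them. *)
Definition phi (x : R) : nat := (count (< x) s + count (<= x) s)%N.

Lemma count_leE x : count (<= x) s = (count (< x) s + (x \in s))%N.
Proof.
rewrite -(count_uniq_mem _ (lt_sorted_uniq sorted_s)).
elim: s => //= c t ->; rewrite le_eqVlt.
by case: (ltgtP c x) => /=; lia.
Qed.

Lemma phiE x : phi x = ((count (< x) s).*2 + (x \in s))%N.
Proof. by rewrite /phi count_leE addnA addnn. Qed.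

Lemma odd_phi x : odd (phi x) = (x \in s).
Proof. by rewrite phiE oddD odd_double; case: (_ \in _). Qed.

Lemma count_le_lt x y : x < y -> (count (<= x) s <= count (< y) s)%N.
Proof. by move=> xy; apply: sub_count => c /= cx; apply: le_lt_trans xy. Qed.

Lemma phi_mono x y : x <= y -> (phi x <= phi y)%N.
Proof.
rewrite le_eqVlt => /orP[/eqP-> //|xy].
have := count_le_lt xy; rewrite !phiE count_leE.
move: (count _ s) (count _ s) (x \in s) (y \in s) => a b c d. lia.
Qed.

Lemma phi_lt x y : x < y -> (x \in s) || (y \in s) -> (phi x < phi y)%N.
Proof.
move=> xy; have := count_le_lt xy; rewrite !phiE count_leE.
move: (count _ s) (count _ s) (x \in s) (y \in s) => a b c d. lia.
Qed.

Lemma phi_ltl x y : x \in s -> (phi x < phi y)%N = (x < y).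
Proof.
move=> xs; case: ltP => [xy|yx]; first by apply: phi_lt => //; rewrite xs.
by apply/negbTE; rewrite -leqNgt; apply: phi_mono.
Qed.

Lemma phi_ltr x y : y \in s -> (phi x < phi y)%N = (x < y).
Proof.
move=> ys; case: ltP => [xy|yx]; first by apply: phi_lt => //; rewrite ys orbT.
by apply/negbTE; rewrite -leqNgt; apply: phi_mono.
Qed.

Lemma phi_inj x y : x \in s -> phi x = phi y -> x = y.
Proof.
move=> xs e; have ys : y \in s by rewrite -odd_phi -e odd_phi.
by case: (ltgtP x y) => // h; have := phi_lt h; rewrite ?xs ?ys e ltnn => /(_ isT).
Qed.

Lemma isolated x : exists2 e, 0 < e & forall y, `|y - x| < e -> y \in s -> y = x.
Proof.
elim: s => [|c t [e e0 he]]; first by exists 1.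
have [->|ne] := eqVneq c x.
  exists e => // y yx; rewrite inE => /orP[/eqP //|]; exact: he.
exists (Num.min e `|c - x|); first by rewrite lt_min e0 normr_gt0 subr_eq0.
move=> y; rewrite lt_min => /andP[h1 h2]; rewrite inE => /orP[/eqP yc|]; last exact: he.
by move: h2; rewrite yc ltxx.
Qed.

Lemma count_gap a b : a <= b -> (forall c, c \in s -> a <= c -> c < b -> False) ->
  count (< a) s = count (< b) s.
Proof.
move=> ab h; apply: eq_in_count => c cs /=; apply/idP/idP => [ca|cb].
  exact: lt_le_trans ca ab.
by rewrite ltNge; apply/negP => ac; exact: h cs ac cb.
Qed.

(** The boolean [odd (phi x)] serves as a shift: 1 at an element of [s], from which one passes to
    the adjacent gaps, and 0 inside a gap. *)
Lemma phi_local x : exists2 e, 0 < e & forall y, `|y - x| < e ->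
  [\/ y = x,
      [/\ y < x, ~~ odd (phi y) & (phi y = phi x - odd (phi x))%N] |
      [/\ x < y, ~~ odd (phi y) & (phi y = phi x + odd (phi x))%N]].
Proof.
have [e e0 he] := isolated x; exists e => // y yx.
have ys : y != x -> y \notin s.
  by move=> ne; apply/negP => ys; rewrite (he y) ?eqxx in ne.
case: (ltgtP y x) => [lt|gt|->]; [apply: Or32|apply: Or33|exact: Or31].
  have {}ys : y \notin s by apply: ys; rewrite lt_eqF.
  split=> //; first by rewrite odd_phi.
  rewrite odd_phi !phiE (negbTE ys) (@count_gap y x) ?ltW //.
    by case: (x \in s); rewrite /= ?subn0 ?addn0 ?addnK.
  move=> c cs yc cx; have e1 := he c.
  suff : c = x by lra.
  apply: e1 => //; move: yx; rewrite !ltr_norml; lra.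
have {}ys : y \notin s by apply: ys; rewrite gt_eqF.
split=> //; first by rewrite odd_phi.
rewrite odd_phi !phiE (negbTE ys).
suff -> : count (< y) s = count (<= x) s by rewrite count_leE; case: (x \in s); rewrite /= ?addn0 ?addn1 ?doubleS //; lia.
apply: eq_in_count => c cs /=; apply/idP/idP => [cy|]; last by lra.
rewrite leNgt; apply/negP => xc.
suff : c = x by lra.
by apply: he => //; move: yx; rewrite !ltr_norml; lra.
Qed.

Lemma phi_left x e : 0 < e -> exists y,
  [/\ x - e < y, y < x, ~~ odd (phi y) & (phi y = phi x - odd (phi x))%N].
Proof.
move=> e0; have [d d0 hd] := phi_local x.
exists (x - Num.min d e / 2).
have m0 : 0 < Num.min d e by rewrite lt_min d0.
have [md me] : Num.min d e <= d /\ Num.min d e <= e.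
  by split; rewrite ge_min lexx ?orbT.
have [|h|[_ h1 h2]|[h _ _]] := hd (x - Num.min d e / 2).
- rewrite ltr_norml; lra.
- by exfalso; lra.
- by split=> //; lra.
- by exfalso; lra.
Qed.

Lemma phi_right x e : 0 < e -> exists y,
  [/\ y < x + e, x < y, ~~ odd (phi y) & (phi y = phi x + odd (phi x))%N].
Proof.
move=> e0; have [d d0 hd] := phi_local x.
exists (x + Num.min d e / 2).
have m0 : 0 < Num.min d e by rewrite lt_min d0.
have [md me] : Num.min d e <= d /\ Num.min d e <= e.
  by split; rewrite ge_min lexx ?orbT.
have [|h|[h _ _]|[_ h1 h2]] := hd (x + Num.min d e / 2).
- rewrite ltr_norml; lra.
- by exfalso; lra.
- by exfalso; lra.
- by split=> //; lra.
Qed.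

Lemma phi_bound x : (phi x <= (size s).*2)%N.
Proof. by rewrite /phi -addnn leq_add ?count_size. Qed.

Lemma phi_surj i : (i <= (size s).*2)%N -> s != [::] -> exists x, phi x = i.
Proof.
move=> hi s0; have m0 : (0 < size s)%N by rewrite lt0n size_eq0.
have nthphi k : (k < size s)%N -> phi (nth 0 s k) = k.*2.+1.
  by move=> hk; rewrite /phi count_lt_nth // count_le_nth //; lia.
have [oi|ei] := boolP (odd i).
  exists (nth 0 s i./2); rewrite nthphi; lia.
have [->|i0] := posnP i.
  have [y [_ _ _ e]] := phi_left (nth 0 s 0) (@ltr01 R).
  by exists y; rewrite e nthphi // odd_double /=; lia.
have [y [_ _ _ e]] := phi_right (nth 0 s i./2.-1) (@ltr01 R).
exists y; rewrite e nthphi; [rewrite /= odd_double /=; lia|lia].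
Qed.

Lemma phi_ivt a b i : s != [::] -> a <= b -> (phi a <= i <= phi b)%N ->
  exists c, [/\ a <= c, c <= b & phi c = i].
Proof.
move=> s0 ab /andP[ai ib].
have [->|ne1] := eqVneq i (phi a); first by exists a.
have [->|ne2] := eqVneq i (phi b); first by exists b.
have [x ex] := phi_surj (leq_trans ib (phi_bound b)) s0; exists x; split=> //.
- rewrite leNgt; apply/negP => /ltW /phi_mono; lia.
- rewrite leNgt; apply/negP => /ltW /phi_mono; lia.
Qed.
End Coord.

(** * Regions bounded by an axis-parallel chain *)

Section Region.
Variables (R : realFieldType) (n : nat).
Implicit Types (P : R * R -> Prop) (v : nat -> R * R) (z w : R * R).

Definition box z e w := `|w.1 - z.1| < e /\ `|w.2 - z.2| < e.

Definition between (a b x : R) := (a <= x <= b) || (b <= x <= a).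

Definition on_edge v k z :=
  [/\ (v k).1 = (v k.+1).1, z.1 = (v k).1 & between (v k).2 (v k.+1).2 z.2] \/
  [/\ (v k).2 = (v k.+1).2, z.2 = (v k).2 & between (v k).1 (v k.+1).1 z.1].

Definition outer P z := forall e, 0 < e -> exists2 w, box z e w & ~ P w.

(** What the grid argument needs of a polygon, in terms of squares and coordinates only. [rg_dense]
    is regular closedness; [rg_segH] and [rg_segV] are connectedness of a segment that misses the
    boundary. Clauses come in pairs exchanged by [rswap], so one direction is proved and the other
    transported. *)
Record region P v : Prop := Region {
  rg_closed : forall z, (forall e, 0 < e -> exists2 w, box z e w & P w) -> P z;
  rg_dense : forall z e, P z -> 0 < e ->
    exists w d, [/\ 0 < d, box z e w & forall u, box w d u -> P u];
  rg_bound : exists B, forall z, P z -> `|z.1| < B /\ `|z.2| < B;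
  rg_axis : forall k, (v k).1 = (v k.+1).1 \/ (v k).2 = (v k.+1).2;
  rg_edge : forall k z, (k < n)%N -> on_edge v k z -> outer P z;
  rg_front : forall z, P z -> outer P z -> exists2 k, (k < n)%N & on_edge v k z;
  rg_segH : forall a b y, a <= b ->
    (forall t, a <= t <= b -> P (t, y) -> outer P (t, y) -> False) -> P (a, y) <-> P (b, y);
  rg_segV : forall a b x, a <= b ->
    (forall t, a <= t <= b -> P (x, t) -> outer P (x, t) -> False) -> P (x, a) <-> P (x, b);
  rg_simple : forall k l z, (k < n)%N -> (l < n)%N -> on_edge v k z -> on_edge v l z ->
    [\/ k = l, z = v k.+1 /\ v l = v k.+1 /\ v l.+1 = v k.+2
      | z = v k /\ v l.+1 = v k /\ v k.+1 = v l.+2];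
  rg_turn1 : forall k, (v k).1 = (v k.+1).1 -> (v k.+1).1 = (v k.+2).1 -> False;
  rg_turn2 : forall k, (v k).2 = (v k.+1).2 -> (v k.+1).2 = (v k.+2).2 -> False
}.

Definition rswap z : R * R := (z.2, z.1).

Lemma rswapK z : rswap (rswap z) = z. Proof. by case: z. Qed.

Lemma box_swap z e w : box (rswap z) e w <-> box z e (rswap w).
Proof. by split=> -[]. Qed.

Lemma outer_swap P z : outer (P \o rswap) z <-> outer P (rswap z).
Proof.
split=> h e e0; have [w [b1 b2] Pw] := h e e0; exists (rswap w) => //.
by case: w Pw {b1 b2}.
Qed.

Lemma on_edge_swap v k z : on_edge (rswap \o v) k z <-> on_edge v k (rswap z).
Proof. by split=> -[]; [right|left|right|left]. Qed.

Lemma region_swap P v : region P v -> region (P \o rswap) (rswap \o v).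
Proof.
case=> h1 h2 [B h3] h4 h5 h6 h7 h8 h9 h10 h11; split.
- move=> z h; apply: h1 => e e0; have [w bw Pw] := h e e0; exists (rswap w); first by split; case: bw.
  by case: w Pw {bw}.
- move=> z e Pz e0; have [w [d [d0 bw hd]]] := h2 _ e Pz e0.
  exists (rswap w), d; split=> //; first by split; case: bw.
  by move=> u /box_swap; exact: hd.
- by exists B => z /h3[].
- by move=> k; case: (h4 k); [right|left].
- by move=> k z kn /on_edge_swap ek; apply/outer_swap; exact: h5 kn ek.
- move=> z Pz /outer_swap o; have [k kn ke] := h6 _ Pz o; exists k => //.
  exact/on_edge_swap.
- by move=> a b y ab h; apply: h8 => // t ht Pt ot; apply: (h t ht Pt); exact/outer_swap.
- by move=> a b y ab h; apply: h7 => // t ht Pt ot; apply: (h t ht Pt); exact/outer_swap.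
- move=> k l z kn ln /on_edge_swap ek /on_edge_swap el.
  case: (h9 _ _ _ kn ln ek el) => [->|[e1 [e2 e3]]|[e1 [e2 e3]]]; [exact: Or31|apply: Or32|apply: Or33].
    by rewrite /= e2 e3 -e1 rswapK.
  by rewrite /= e2 e3 -e1 rswapK.
- by move=> k; exact: h11.
- by move=> k; exact: h10.
Qed.

(** * The cells met by a region *)

Section Grid.
Variables (P : R * R -> Prop) (v : nat -> R * R) (sx sy : seq R).
Hypothesis rg : region P v.
Hypothesis sort_x : sorted <%R sx.
Hypothesis sort_y : sorted <%R sy.
Hypothesis vx : forall k, (v k).1 \in sx.
Hypothesis vy : forall k, (v k).2 \in sy.

Definition Phi z : cell := (phi sx z.1, phi sy z.2).
Definition grid (c : cell) : Prop := exists2 z, P z & Phi z = c.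

Lemma on_edge_odd k z : on_edge v k z -> (z.1 \in sx) || (z.2 \in sy).
Proof. by case=> -[_ -> _]; rewrite ?vx ?vy ?orbT. Qed.

(** Boundary points have an odd index, so a horizontal and then a vertical segment inside an open
    face never meet the boundary. *)
Lemma full_inv z w : ~~ odd (phi sx z.1) -> ~~ odd (phi sy z.2) ->
  Phi z = Phi w -> P z -> P w.
Proof.
case: z w => [a y] [b y'] /=; rewrite /Phi /= => ea ey [eab eyy].
have H t u : phi sx t = phi sx a -> phi sy u = phi sy y -> ~ (P (t, u) /\ outer P (t, u)).
  move=> et eu [Pt ot]; have [k _ /on_edge_odd] := rg_front rg Pt ot.
  by rewrite /= -(odd_phi sort_x) -(odd_phi sort_y) et eu (negbTE ea) (negbTE ey).
move=> Pay; have Pby : P (b, y).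
  case: (leP a b) => [ab|/ltW ba].
    apply/(rg_segH rg ab) => // t /andP[/(phi_mono sort_x) h1 /(phi_mono sort_x) h2] Pt ot.
    by apply: (@H t y) => //; lia.
  apply/(rg_segH rg ba) => // t /andP[/(phi_mono sort_x) h1 /(phi_mono sort_x) h2] Pt ot.
  by apply: (@H t y) => //; lia.
case: (leP y y') => [ab|/ltW ba].
  apply/(rg_segV rg ab) => // t /andP[/(phi_mono sort_y) h1 /(phi_mono sort_y) h2] Pt ot.
  by apply: (@H b t) => //; lia.
apply/(rg_segV rg ba) => // t /andP[/(phi_mono sort_y) h1 /(phi_mono sort_y) h2] Pt ot.
by apply: (@H b t) => //; lia.
Qed.

(** [rg_dense] puts a whole square into [P], and finitely many vertex lines do not cover a
    square. *)
Lemma near_full z e : P z -> 0 < e ->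
  exists w, [/\ P w, box z e w, ~~ odd (phi sx w.1) & ~~ odd (phi sy w.2)].
Proof.
move=> Pz e0; have e2 : 0 < e / 2 by lra.
have [w [d [d0 [b1 b2] hd]]] := rg_dense rg Pz e2.
have m0 : 0 < Num.min d (e / 2) by rewrite lt_min d0.
have [md me] : Num.min d (e / 2) <= d /\ Num.min d (e / 2) <= e / 2.
  by split; rewrite ge_min lexx ?orbT.
have [x [x1 x2 x3 _]] := phi_right sort_x w.1 m0.
have [y [y1 y2 y3 _]] := phi_right sort_y w.2 m0.
exists (x, y); split=> //.
  by apply: hd; split; rewrite /= ltr_norml; lra.
by split; move: b1 b2; rewrite /= !ltr_norml; lra.
Qed.

Lemma coord_match (s : seq R) x y x' e : sorted <%R s -> phi s x = phi s y -> 0 < e ->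
  [\/ x' = x,
      [/\ x' < x, ~~ odd (phi s x') & (phi s x' = phi s x - odd (phi s x))%N] |
      [/\ x < x', ~~ odd (phi s x') & (phi s x' = phi s x + odd (phi s x))%N]] ->
  exists2 y', `|y' - y| < e & phi s y' = phi s x'.
Proof.
move=> ss exy e0; case=> [->|[_ _ ->]|[_ _ ->]].
- by exists y; rewrite ?subrr ?normr0.
- have [y' [h1 h2 _ h3]] := phi_left ss y e0.
  by exists y'; [rewrite ltr_norml; lra | rewrite h3 exy].
- have [y' [h1 h2 _ h3]] := phi_right ss y e0.
  by exists y'; [rewrite ltr_norml; lra | rewrite h3 exy].
Qed.

(** On vertex lines too, [P] is a union of cells: a face of [P] touching [z] also touches [w], where
    [coord_match] finds points of it arbitrarily close, and [P] is closed. *)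
Lemma phi_inv z w : Phi z = Phi w -> P z -> P w.
Proof.
move=> [ex ey] Pz; apply: (rg_closed rg) => e e0.
have [e1 e10 h1] := phi_local sort_x z.1; have [e2 e20 h2] := phi_local sort_y z.2.
have m0 : 0 < Num.min e1 e2 by rewrite lt_min e10.
have [u [Pu [b1 b2] o1 o2]] := near_full Pz m0.
have {}b1 : `|u.1 - z.1| < e1 by apply: lt_le_trans b1 _; rewrite ge_min lexx.
have {}b2 : `|u.2 - z.2| < e2 by apply: lt_le_trans b2 _; rewrite ge_min lexx orbT.
have [x hx hx'] := coord_match sort_x ex e0 (h1 _ b1).
have [y hy hy'] := coord_match sort_y ey e0 (h2 _ b2).
exists (x, y) => //; apply: full_inv Pu => //.
by rewrite /Phi hx' hy'.
Qed.

Lemma gridP z : grid (Phi z) <-> P z.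
Proof. by split=> [[w Pw /esym e]|]; [exact: phi_inv (esym e) Pw | exists z]. Qed.

Lemma phi_far_right z : P z -> exists2 b, z.1 < b & (phi sx z.1 < phi sx b)%N.
Proof.
move=> Pz; have [B hB] := rg_bound rg; have [hz _] := hB _ Pz.
have zb : z.1 < B + 1 by move: hz; rewrite ltr_norml; lra.
exists (B + 1) => //.
rewrite ltn_neqAle (phi_mono sort_x (ltW zb)) andbT; apply/eqP => e.
have : P (B + 1, z.2) by apply: phi_inv Pz; rewrite /Phi e.
by move=> /hB[/=]; rewrite ltr_norml; lra.
Qed.

Lemma phi_far_left z : P z -> exists2 b, b < z.1 & (phi sx b < phi sx z.1)%N.
Proof.
move=> Pz; have [B hB] := rg_bound rg; have [hz _] := hB _ Pz.
have zb : - B - 1 < z.1 by move: hz; rewrite ltr_norml; lra.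
exists (- B - 1) => //.
rewrite ltn_neqAle (phi_mono sort_x (ltW zb)) andbT; apply/eqP => e.
have : P (- B - 1, z.2) by apply: phi_inv Pz; rewrite /Phi e.
by move=> /hB[/=]; rewrite ltr_norml; lra.
Qed.

Lemma sx_neq0 : sx != [::].
Proof. by apply/eqP => e; have := vx 0; rewrite e. Qed.

(** Points of a gap approach its bounding lines within [P], which is closed. That there is a line on
    either side comes from boundedness. *)
Lemma grid_closeH i j : grid (i, j) -> ~~ odd i -> grid (i.-1, j) /\ grid (i.+1, j).
Proof.
case=> -[a y] Pz [<- <-] /= ei.
have onto x t : (forall e, 0 < e -> exists2 t, `|t - x| < e & phi sx t = phi sx a) -> t = phi sx x ->
    grid (t, phi sy y).
  move=> h ->; exists (x, y) => //; apply: (rg_closed rg) => e e0.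
  have [t' h1 h2] := h e e0; exists (t', y); first by split; rewrite /= ?subrr ?normr0.
  by apply: phi_inv Pz; rewrite /Phi /= h2.
split.
  have [b ba lt] := phi_far_left Pz; rewrite /= in ba lt.
  have [||x [bx xa ex]] := @phi_ivt _ _ sort_x b a (phi sx a).-1 sx_neq0; [exact: ltW | lia |].
  apply: (onto x) => // e e0.
  have xs : x \in sx by rewrite -(odd_phi sort_x) ex; lia.
  have [t [h1 h2 _ h3]] := phi_right sort_x x e0.
  exists t; first by rewrite ltr_norml; lra.
  by rewrite h3 odd_phi // xs ex addn1 (ltn_predK lt).
have [b ba lt] := phi_far_right Pz; rewrite /= in ba lt.
have [||x [bx xa ex]] := @phi_ivt _ _ sort_x a b (phi sx a).+1 sx_neq0; [exact: ltW | lia |].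
apply: (onto x) => // e e0.
have xs : x \in sx by rewrite -(odd_phi sort_x) ex; lia.
have [t [h1 h2 _ h3]] := phi_left sort_x x e0.
exists t; first by rewrite ltr_norml; lra.
by rewrite h3 odd_phi // xs ex subn1.
Qed.

Lemma grid_pos i j : grid (i, j) -> (0 < i)%N /\ (i < (size sx).*2.+1)%N.
Proof.
case=> -[a y] Pz [<- _]; have [b _ lt] := phi_far_left Pz.
by have := phi_bound sx a; rewrite /= in lt *; lia.
Qed.

Lemma phi_spans (s : seq R) a b x : sorted <%R s -> a \in s -> b \in s ->
  spans (phi s a) (phi s b) (phi s x) = (a < x < b) || (b < x < a).
Proof.
move=> ss sa sb; rewrite /spans.
by rewrite (phi_ltl ss x sa) (phi_ltl ss x sb) (phi_ltr ss x sa) (phi_ltr ss x sb).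
Qed.

Lemma on_edge_spans k z : on_edge v k z -> z.2 \notin sy ->
  [/\ z.1 = (v k).1, (v k.+1).1 = (v k).1 &
     spans (phi sy (v k).2) (phi sy (v k.+1).2) (phi sy z.2)].
Proof.
move=> ek zy; case: ek => -[e1 e2 bt]; last by rewrite e2 vy in zy.
split=> //; have n1 : z.2 != (v k).2 by apply: contraNneq zy => ->.
have n2 : z.2 != (v k.+1).2 by apply: contraNneq zy => ->.
rewrite phi_spans //; move: bt; rewrite /between !le_eqVlt.
by rewrite ![_ == z.2]eq_sym (negbTE n1) (negbTE n2).
Qed.

(** With cells of [P] on both sides, a point inside the edge would have a whole neighbourhood in
    [P], against [rg_edge]. *)
Lemma grid_edgeV k i j : (k < n)%N -> phi sx (v k).1 = i -> phi sx (v k.+1).1 = i ->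
  spans (phi sy (v k).2) (phi sy (v k.+1).2) j -> ~~ odd j ->
  grid (i.-1, j) -> grid (i.+1, j) -> False.
Proof.
move=> kn e1 e2 sp oj g1 g2.
have e12 : (v k).1 = (v k.+1).1 by apply: (phi_inj sort_x) => //; rewrite e1 e2.
have oi : odd i by rewrite -e1 odd_phi.
have [z Pz [ez1 ez2]] := g1.
have bt : between (v k).2 (v k.+1).2 z.2.
  rewrite -ez2 phi_spans // in sp.
  by rewrite /between; case/orP: sp => /andP[/ltW -> /ltW ->]; rewrite ?orbT.
pose w := ((v k).1, z.2).
have ow : on_edge v k w by left.
have ei1 : ~~ odd i.-1 by lia.
have g0 : grid (i, j) by have [_] := grid_closeH g1 ei1; rewrite prednK //; lia.
have [d1 d10 h1] := phi_local sort_x w.1; have [d2 d20 h2] := phi_local sort_y w.2.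
have m0 : 0 < Num.min d1 d2 by rewrite lt_min d10.
have [u [b1 b2]] := rg_edge rg kn ow m0; apply; apply/gridP; rewrite /Phi.
have {}b1 : `|u.1 - w.1| < d1 by apply: lt_le_trans b1 _; rewrite ge_min lexx.
have {}b2 : `|u.2 - w.2| < d2 by apply: lt_le_trans b2 _; rewrite ge_min lexx orbT.
have -> : phi sy u.2 = j.
  have := h2 u.2 b2; rewrite /w /= ez2 (negbTE oj) subn0 addn0.
  by case=> [->|[]|[]].
have := h1 u.1 b1; rewrite /w /= e1 oi; case=> [->|[_ _ ->]|[_ _ ->]]; rewrite ?e1 ?subn1 ?addn1 //.
Qed.

Lemma grid_bdV i j : odd i -> ~~ odd j -> grid (i, j) ->
  ~ (grid (i.-1, j) /\ grid (i.+1, j)) ->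
  exists k, [/\ (k < n)%N, phi sx (v k).1 = i, phi sx (v k.+1).1 = i
     & spans (phi sy (v k).2) (phi sy (v k.+1).2) j].
Proof.
move=> oi ej [z Pz [ez1 ez2]] ng.
have [|k kn ek] := rg_front rg Pz.
  move=> e e0; apply: contrapT => nw; apply: ng.
  have al w : box z e w -> P w by move=> bw; apply: contrapT => nP; apply: nw; exists w.
  have bx x : z.1 - e < x -> x < z.1 + e -> P (x, z.2).
    by move=> h1 h2; apply: al; split; rewrite /= ?subrr ?normr0 // ltr_norml; lra.
  split.
    have [x [h1 h2 _ h3]] := phi_left sort_x z.1 e0; exists (x, z.2); first by apply: bx; lra.
    by rewrite /Phi /= h3 ez1 ez2 oi subn1.
  have [x [h1 h2 _ h3]] := phi_right sort_x z.1 e0; exists (x, z.2); first by apply: bx; lra.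
  by rewrite /Phi /= h3 ez1 ez2 oi addn1.
have zy : z.2 \notin sy by rewrite -(odd_phi sort_y) ez2.
have [e1 e2 sp] := on_edge_spans ek zy.
by exists k; rewrite e2 -e1 ez1 -ez2.
Qed.

End Grid.

Lemma grid_swap P v sx sy c :
  grid (P \o rswap) sy sx c <-> grid P sx sy (swap c).
Proof.
split=> -[z Pz e].
  by exists (rswap z) => //; rewrite -e.
exists (rswap z); first by rewrite /= rswapK.
by case: c e => c1 c2 [<- <-].
Qed.

(** * The cells of a region satisfy the grid conditions *)

Section GridChain.
Variables (P : R * R -> Prop) (v : nat -> R * R) (sx sy : seq R).
Hypothesis rg : region P v.
Hypothesis sort_x : sorted <%R sx.
Hypothesis sort_y : sorted <%R sy.
Hypothesis vx : forall k, (v k).1 \in sx.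
Hypothesis vy : forall k, (v k).2 \in sy.

Let rg' := region_swap rg.
Let vx' : forall k, ((rswap \o v) k).1 \in sy := vy.
Let vy' : forall k, ((rswap \o v) k).2 \in sx := vx.
Notation M := (grid P sx sy).

Lemma grid_closeV i j : M (i, j) -> ~~ odd j -> M (i, j.-1) /\ M (i, j.+1).
Proof.
move=> g ej; have /(grid_closeH rg' sort_y sort_x vx' vy') : grid (P \o rswap) sy sx (j, i).
  exact/grid_swap.
by case/(_ ej) => /grid_swap h1 /grid_swap h2; split; [exact: h1 | exact: h2].
Qed.

Lemma grid_bounded : bounded (maxn (size sx) (size sy)).*2.+1 M.
Proof.
case=> i j g; have [h1 h2] := grid_pos rg sort_x sort_y vx vy g.
have [h3 h4] : (0 < j)%N /\ (j < (size sy).*2.+1)%N.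
  by apply: (grid_pos rg' sort_y sort_x vx' vy' (j := i)); apply/grid_swap.
by split=> //=; lia.
Qed.

Lemma phi_le (s : seq R) a x : sorted <%R s -> a \in s ->
  ((phi s a <= phi s x)%N = (a <= x)) * ((phi s x <= phi s a)%N = (x <= a)).
Proof.
by move=> ss sa; split; [rewrite leqNgt phi_ltr // leNgt | rewrite leqNgt phi_ltl // leNgt].
Qed.

(** Edges end at odd indices, so one that spans the even row [t] contains the grid points next to it
    in either direction. *)
Lemma edge_thruV k i j t z : phi sx (v k).1 = i -> phi sx (v k.+1).1 = i ->
  spans (phi sy (v k).2) (phi sy (v k.+1).2) t -> ~~ odd t -> (t = j.+1 \/ j = t.+1)%N ->
  Phi sx sy z = (i, j) -> on_edge v k z.
Proof.
move=> e1 e2 sp et tj [z1 z2]; left; split.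
- by apply: (phi_inj sort_x) => //; rewrite e1 e2.
- by symmetry; apply: (phi_inj sort_x) => //; rewrite e1.
rewrite /between -!(phi_le _ sort_y (vy _)) z2.
have := odd_phi sort_y (v k).2; have := odd_phi sort_y (v k.+1).2; rewrite !vy.
by move: sp; rewrite /spans; lia.
Qed.

Lemma edge_thruH k i j t z : phi sy (v k).2 = j -> phi sy (v k.+1).2 = j ->
  spans (phi sx (v k).1) (phi sx (v k.+1).1) t -> ~~ odd t -> (t = i.+1 \/ i = t.+1)%N ->
  Phi sx sy z = (i, j) -> on_edge v k z.
Proof.
move=> e1 e2 sp et ti [z1 z2]; right; split.
- by apply: (phi_inj sort_y) => //; rewrite e1 e2.
- by symmetry; apply: (phi_inj sort_y) => //; rewrite e1.
rewrite /between -!(phi_le _ sort_x (vx _)) z1.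
have := odd_phi sort_x (v k).1; have := odd_phi sort_x (v k.+1).1; rewrite !vx.
by move: sp; rewrite /spans; lia.
Qed.

(** Excludes a T-junction of the chain. If [kU] and [kD] are the same edge, the grid point is
    interior to it and cannot lie on a horizontal edge. If they are consecutive, two vertical edges
    follow each other, against [rg_turn1]. *)
Lemma no_cross i j t kU kD kR : odd j ->
  (kU < n)%N -> phi sx (v kU).1 = i -> phi sx (v kU.+1).1 = i ->
  spans (phi sy (v kU).2) (phi sy (v kU.+1).2) j.+1 ->
  (kD < n)%N -> phi sx (v kD).1 = i -> phi sx (v kD.+1).1 = i ->
  spans (phi sy (v kD).2) (phi sy (v kD.+1).2) j.-1 ->
  (kR < n)%N -> phi sy (v kR).2 = j -> phi sy (v kR.+1).2 = j ->
  spans (phi sx (v kR).1) (phi sx (v kR.+1).1) t -> ~~ odd t -> (t = i.+1 \/ i = t.+1)%N ->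
  False.
Proof.
move=> oj nU U1 U2 sU nD D1 D2 sD nR R1 R2 sR et ti.
pose z := ((v kU).1, (v kR).2).
have ez : Phi sx sy z = (i, j) by rewrite /Phi /= U1 R1.
have thU : on_edge v kU z.
  by apply: (edge_thruV (t := j.+1)) ez => //=; [lia | left].
have thD : on_edge v kD z.
  by apply: (edge_thruV (t := j.-1)) ez => //=; [lia | right; lia].
have thR : on_edge v kR z by apply: (edge_thruH (t := t)) ez.
have eq1 k : phi sx (v k).1 = i -> phi sx (v k.+1).1 = i -> (v k).1 = (v k.+1).1.
  by move=> a b; apply: (phi_inj sort_x) => //; rewrite a b.
case: (rg_simple rg nU nD thU thD) => [e|[_ [e1 e2]]|[_ [e1 e2]]].
- rewrite -e in sD.
  case: (rg_simple rg nU nR thU thR) => [e'|[e' _]|[e' _]].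
  + by move: sU; rewrite e' R1 R2 /spans; lia.
  + by move: sU sD; rewrite -e' /z /= R1 /spans; lia.
  + by move: sU sD; rewrite -e' /z /= R1 /spans; lia.
- by apply: (rg_turn1 rg (eq1 _ U1 U2)); rewrite -e1 -e2; apply: eq1.
- by apply: (rg_turn1 rg (eq1 _ D1 D2)); rewrite e1 -e2; apply: eq1.
Qed.

Lemma grid_bdH i j : ~~ odd i -> odd j -> M (i, j) -> ~ (M (i, j.-1) /\ M (i, j.+1)) ->
  exists k, [/\ (k < n)%N, phi sy (v k).2 = j, phi sy (v k.+1).2 = j
     & spans (phi sx (v k).1) (phi sx (v k.+1).1) i].
Proof.
move=> ei oj g ng.
have [||k hk] := grid_bdV rg' sort_y sort_x vy' oj ei; last by exists k.
  exact/grid_swap.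
by case=> /grid_swap h1 /grid_swap h2; apply: ng; split; [exact: h1 | exact: h2].
Qed.

Lemma grid_near i j : M (i, j) ->
  (odd i -> M (i.-1, j) \/ M (i.+1, j)) /\ (odd j -> M (i, j.-1) \/ M (i, j.+1)).
Proof.
case=> z Pz [ei ej].
have [d1 d10 h1] := phi_local sort_x z.1; have [d2 d20 h2] := phi_local sort_y z.2.
have m0 : 0 < Num.min d1 d2 by rewrite lt_min d10.
have [u [Pu [b1 b2] o1 o2]] := near_full rg sort_x sort_y Pz m0.
have {}b1 : `|u.1 - z.1| < d1 by apply: lt_le_trans b1 _; rewrite ge_min lexx.
have {}b2 : `|u.2 - z.2| < d2 by apply: lt_le_trans b2 _; rewrite ge_min lexx orbT.
have Mu : M (phi sx u.1, phi sy u.2) by exists u.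
have eu1 := h1 _ b1; have eu2 := h2 _ b2; rewrite ei in eu1; rewrite ej in eu2.
have [c1 c2] := grid_closeH rg sort_x sort_y vx vy Mu o1.
have [c3 c4] := grid_closeV Mu o2.
have onrow : M (phi sx u.1, j).
  move: eu2; case=> [e|[_ _ e]|[_ _ e]].
  - by rewrite -ej -e.
  - case: (boolP (odd j)) e => oj; rewrite ?subn0 => e; last by rewrite -e.
    by rewrite e subn1 (prednK (odd_gt0 oj)) in c4.
  - case: (boolP (odd j)) e => oj; rewrite ?addn0 => e; last by rewrite -e.
    by rewrite e addn1 in c3.
have oncol : M (i, phi sy u.2).
  move: eu1; case=> [e|[_ _ e]|[_ _ e]].
  - by rewrite -ei -e.
  - case: (boolP (odd i)) e => oi; rewrite ?subn0 => e; last by rewrite -e.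
    by rewrite e subn1 (prednK (odd_gt0 oi)) in c2.
  - case: (boolP (odd i)) e => oi; rewrite ?addn0 => e; last by rewrite -e.
    by rewrite e addn1 in c1.
split=> [oi|oj].
  move: eu1 onrow; rewrite oi; case=> [e|[_ _ ->]|[_ _ ->]].
  - by rewrite e ei oi in o1.
  - by rewrite subn1; left.
  - by rewrite addn1; right.
move: eu2 oncol; rewrite oj; case=> [e|[_ _ ->]|[_ _ ->]].
- by rewrite e ej oj in o2.
- by rewrite subn1; left.
- by rewrite addn1; right.
Qed.

Lemma region_grid_chain : grid_chain n (Phi sx sy \o v) M.
Proof.
(* If only two diagonal faces at a grid point were in [M], the unit edges there would all be
   boundary, and three of them already form the junction excluded by [no_cross]. *)
have pinch i j : odd i -> odd j -> M (i.-1, j.-1) -> M (i.+1, j.+1) ->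
    M (i.-1, j.+1) \/ M (i.+1, j.-1).
  move=> oi oj g1 g2; apply: contrapT => /not_orP[n1 n2].
  have [|gV _] := grid_closeV g2; first by rewrite /= oj.
  have [|gU _] := grid_closeH rg sort_x sort_y vx vy g2; first by rewrite /= oi.
  have [|_ gD] := grid_closeH rg sort_x sort_y vx vy g1; first lia.
  rewrite /= prednK in gD; last lia.
  have [|[]//|kU [nU U1 U2 sU]] := grid_bdV rg sort_x sort_y vy oi _ gU; first by rewrite /= oj.
  have [|[]//|kD [nD D1 D2 sD]] := grid_bdV rg sort_x sort_y vy oi _ gD; first lia.
  have [|[]//|kR [nR R1 R2 sR]] := grid_bdH _ oj gV; first by rewrite /= oi.
  by apply: (no_cross (t := i.+1) oj nU U1 U2 sU nD D1 D2 sD nR R1 R2 sR); [rewrite /= oi | left].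
have pinch' i j : odd i -> odd j -> M (i.-1, j.+1) -> M (i.+1, j.-1) ->
    M (i.-1, j.-1) \/ M (i.+1, j.+1).
  move=> oi oj g1 g2; apply: contrapT => /not_orP[n1 n2].
  have [|_ gV] := grid_closeV g2; first lia.
  rewrite prednK in gV; last lia.
  have [|_ gU] := grid_closeH rg sort_x sort_y vx vy g1; first lia.
  rewrite prednK in gU; last lia.
  have [|gD _] := grid_closeH rg sort_x sort_y vx vy g2; first by rewrite /= oi.
  have [|[]//|kU [nU U1 U2 sU]] := grid_bdV rg sort_x sort_y vy oi _ gU; first by rewrite /= oj.
  have [|[]//|kD [nD D1 D2 sD]] := grid_bdV rg sort_x sort_y vy oi _ gD; first lia.
  have [|[]//|kR [nR R1 R2 sR]] := grid_bdH _ oj gV; first by rewrite /= oi.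
  by apply: (no_cross (t := i.+1) oj nU U1 U2 sU nD D1 D2 sD nR R1 R2 sR); [rewrite /= oi | left].
split=> //.
- by move=> k; rewrite /= !odd_phi // vx vy.
- by move=> k; case: (rg_axis rg k) => e; [left|right]; rewrite /= e.
- exact: (grid_closeH rg sort_x sort_y vx vy).
- exact: grid_closeV.
- by move=> i j /grid_near[].
- by move=> i j /grid_near[].
- by move=> k i j; exact: (grid_edgeV rg sort_x sort_y vx vy).
- move=> k i j kn e1 e2 sp ei g1 g2.
  by apply: (grid_edgeV rg' sort_y sort_x vx' vy' kn e1 e2 sp ei); apply/grid_swap.
- by move=> i j; exact: (grid_bdV rg sort_x sort_y vy).
- exact: grid_bdH.
Qed.

Lemma coord_step (s : seq R) x' x (A : nat -> Prop) (B : Prop) :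
  [\/ x' = x,
      [/\ x' < x, ~~ odd (phi s x') & (phi s x' = phi s x - odd (phi s x))%N] |
      [/\ x < x', ~~ odd (phi s x') & (phi s x' = phi s x + odd (phi s x))%N]] ->
  A (phi s x') -> (~~ odd (phi s x') -> A (phi s x').-1 /\ A (phi s x').+1) ->
  ((phi s x).+1 = phi s x' \/ phi s x = (phi s x').+1 -> B) ->
  A (phi s x) /\ (phi s x' = phi s x \/ B).
Proof.
move=> h; have {h} : phi s x' = phi s x \/ ~~ odd (phi s x') /\
    ((phi s x).+1 = phi s x' \/ phi s x = (phi s x').+1).
  by case: h => [->|[_]|[_]]; [left | |]; move: (phi s x) (phi s x') => a b;
    clear; case: (boolP (odd a)) => /=; lia.
case=> [->|[no d]] Aa h hB; first by split=> //; left.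
have [h1 h2] := h no; split; last by right; apply: hB.
by case: d => [d|->] //; rewrite -d in h1.
Qed.

(** A nearby cell differs from that of [z] by at most one step in each coordinate, and the
    intermediate cell is present by [grid_closeH]. *)
Lemma grid_conn_local z : P z -> exists2 e, 0 < e & forall w, box z e w -> P w ->
  conn M (Phi sx sy w) (Phi sx sy z).
Proof.
move=> Pz.
have [d1 d10 h1] := phi_local sort_x z.1; have [d2 d20 h2] := phi_local sort_y z.2.
exists (Num.min d1 d2); first by rewrite lt_min d10.
move=> w [b1 b2] Pw.
have {}b1 : `|w.1 - z.1| < d1 by apply: lt_le_trans b1 _; rewrite ge_min lexx.
have {}b2 : `|w.2 - z.2| < d2 by apply: lt_le_trans b2 _; rewrite ge_min lexx orbT.
have Mw : M (phi sx w.1, phi sy w.2) by exists w.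
have Mz : M (phi sx z.1, phi sy z.2) by exists z.
have [M1 a1] : M (phi sx z.1, phi sy w.2) /\
    (phi sx w.1 = phi sx z.1 \/ adj (phi sx w.1, phi sy w.2) (phi sx z.1, phi sy w.2)).
  apply: (coord_step (A := fun i => M (i, phi sy w.2)) (h1 _ b1)) => // h.
  - exact: (grid_closeH rg sort_x sort_y vx vy).
  - by rewrite /adj /= eqxx; move: (phi sx w.1) (phi sx z.1) (phi sy w.2) h => a b c; clear; lia.
have [_ a2] : M (phi sx z.1, phi sy z.2) /\
    (phi sy w.2 = phi sy z.2 \/ adj (phi sx z.1, phi sy w.2) (phi sx z.1, phi sy z.2)).
  apply: (coord_step (A := fun j => M (phi sx z.1, j)) (h2 _ b2)) => // h.
  - exact: grid_closeV.
  - by rewrite /adj /= eqxx; move: (phi sx z.1) (phi sy z.2) (phi sy w.2) h => a b c; clear; lia.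
apply: (@conn_trans _ _ (phi sx z.1, phi sy w.2)).
  by case: a1 => [e|a]; [rewrite /Phi e; exact: conn_refl | apply: (conn_step _ a M1); exact: conn_refl].
by case: a2 => [e|a]; [rewrite /Phi e; exact: conn_refl | apply: (conn_step _ a Mz); exact: conn_refl].
Qed.

End GridChain.

End Region.

(** * Polygons as regions *)

Lemma nbhs_box (R : realType) (z : R * R) (B : set (R * R)) :
  nbhs z B <-> exists2 e, 0 < e & forall w, box z e w -> B w.
Proof.
split=> [/nbhs_ballP[e /= e0 h]|[e e0 h]].
  by exists e => // w [h1 h2]; apply: h; split; rewrite /= /ball /= distrC.
apply/nbhs_ballP; exists e => //= w [h1 h2]; apply: h.
by split; rewrite distrC.
Qed.

Lemma between_segment (R : realType) (a b x : R) :
  between a b x <-> exists t : R, [/\ 0 <= t, t <= 1 & x = (1 - t) * a + t * b].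
Proof.
rewrite /between; split=> [h|[t [t0 t1 ->]]]; last by case: (leP a b) => ab; apply/orP; [left|right]; nra.
have [e|ne] := eqVneq a b.
  by exists 0; split=> //; case/orP: h => /andP[]; rewrite e; lra.
have nz : b - a != 0 by rewrite subr_eq0 eq_sym.
exists ((x - a) / (b - a)); split; last by field.
  case/orP: h => /andP[h1 h2]; first by rewrite divr_ge0; lra.
  by rewrite -mulrNN -invrN divr_ge0; lra.
case/orP: h => /andP[h1 h2].
  by rewrite ler_pdivrMr; lra.
by rewrite ler_ndivrMr; lra.
Qed.

Lemma segment_axis (R : realType) (a b z : R * R) : a.1 = b.1 \/ a.2 = b.2 ->
  segment a b z <-> ([/\ a.1 = b.1, z.1 = a.1 & between a.2 b.2 z.2] \/
    [/\ a.2 = b.2, z.2 = a.2 & between a.1 b.1 z.1]).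
Proof.
move=> ax; split.
  case=> t [t0 t1 ->] /=; case: ax => e; [left|right]; split=> //; first [by rewrite -e; ring | by apply/between_segment; exists t].
case=> -[e ez /between_segment[t [t0 t1 et]]]; exists t; split=> //; case: z ez et => z1 z2 /= -> ->.
  by rewrite -e; congr pair; ring.
by rewrite -e; congr pair; ring.
Qed.

Lemma pair_continuousr (R : realType) (x : R) : continuous (fun t : R => (x, t)).
Proof.
move=> t; apply: (@cvg_pair _ _ _ (nbhs t) (nbhs x) (nbhs t) _ _ _ (fun=> x) id).
  exact: cvg_cst.
exact: cvg_id.
Qed.

Lemma pair_continuousl (R : realType) (y : R) : continuous (fun t : R => (t, y)).
Proof.
move=> t; apply: (@cvg_pair _ _ _ (nbhs t) (nbhs t) (nbhs y) _ _ _ id (fun=> y)).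
  exact: cvg_id.
exact: cvg_cst.
Qed.

Section Polygon.
Variables (R : realType) (n : nat) (P : set (R * R)) (v : 'I_n -> R * R).
Hypothesis Pcompact : compact P.
Hypothesis Pconnected : connected P.
Hypothesis Pregular : regclosed P.
Hypothesis simple : simple_closed_chain v.
Hypothesis ortho : orthogonal_chain v.
Hypothesis frontE : frontier P = \bigcup_(i in [set: 'I_n]) edge v i.

Let n_gt0 : (0 < n)%N.
Proof. by case: simple => h _ _ _; apply: leq_trans h. Qed.

Definition cyc k : 'I_n := Ordinal (ltn_pmod k n_gt0).
Definition vert k := v (cyc k).

Lemma ordS_cyc k : ordS (cyc k) = cyc k.+1.
Proof. by apply: val_inj; rewrite /= -addn1 modnDml addn1. Qed.

Lemma cyc_ord (i : 'I_n) : cyc i = i.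
Proof. by apply: val_inj; rewrite /= modn_small. Qed.

Lemma vert_axis k : (vert k).1 = (vert k.+1).1 \/ (vert k).2 = (vert k.+1).2.
Proof. by rewrite /vert -ordS_cyc; exact: ortho. Qed.

Lemma edgeE k z : edge v (cyc k) z <-> on_edge vert k z.
Proof. by rewrite /edge ordS_cyc; apply: segment_axis; exact: vert_axis. Qed.

Lemma Pclosed : closed P.
Proof. by rewrite -Pregular; exact: closed_closure. Qed.

Lemma not_interior z : ~ P^° z <-> outer P z.
Proof.
split=> [h e e0|h /nbhs_box[e e0 he]]; last first.
  by have [w bw] := h e e0; apply; exact: he.
apply: contrapT => nw; apply: h; apply/nbhs_box; exists e => // w bw.
by apply: contrapT => nP; apply: nw; exists w.
Qed.

Lemma frontier_outer z : P z -> frontier P z <-> outer P z.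
Proof.
move=> Pz; rewrite -not_interior; split=> [[]//|h].
by split=> //; exact: subset_closure.
Qed.

(** As the path avoids the boundary, [P] and its interior have the same preimage in [[a, b]], which
    is therefore open and closed in a connected set. *)
Lemma path_const (f : R -> R * R) a b : continuous f -> a <= b ->
  (forall t, a <= t <= b -> P (f t) -> outer P (f t) -> False) ->
  P (f a) <-> P (f b).
Proof.
move=> cf ab h.
have inab t : `[a, b]%classic t -> a <= t <= b by rewrite /= in_itv.
have aa : `[a, b]%classic a by rewrite /= in_itv /= lexx.
have bb : `[a, b]%classic b by rewrite /= in_itv /= lexx andbT.
have E : `[a, b] `&` f @^-1` P = `[a, b] `&` f @^-1` P^°.
  apply/seteqP; split=> t [tab Pt]; split=> //; last exact: interior_subset Pt.
  by apply: contrapT => /not_interior; apply: h (inab _ tab) Pt.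
have K t : `[a, b]%classic t -> P (f t) -> `[a, b] `&` f @^-1` P = `[a, b]%classic.
  move=> tab Pt; apply: (@segment_connected R a b); first by exists t.
  - exists (f @^-1` P^°) => //; apply: open_comp => [? _|]; [exact: cf | exact: open_interior].
  - exists (f @^-1` P) => //; apply: closed_comp => [? _|]; [exact: cf | exact: Pclosed].
split=> Pt.
  by have := bb; rewrite -(K a aa Pt) => -[].
by have := aa; rewrite -(K b bb Pt) => -[].
Qed.

Lemma polygon_region : region n P vert.
Proof.
have [n2 turn adjE disj] := simple; split.
- move=> z h; apply: Pclosed => B /nbhs_box[e e0 he].
  by have [w bw Pw] := h e e0; exists w; split=> //; exact: he.
- move=> z e Pz e0; have : closure P^° z by rewrite Pregular.
  case/(_ (box z e)); first by apply/nbhs_box; exists e.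
  by move=> w [/nbhs_box[d d0 hd] bw]; exists w, d.
- have [B [_ hB]] := compact_bounded Pcompact.
  exists (Num.max B 0 + 2) => z Pz.
  have := hB (Num.max B 0 + 1) _ z Pz; rewrite /= prod_normE.
  have : B <= Num.max B 0 by rewrite le_max lexx.
  rewrite ge_max => Bm /(_ _)/andP[]; first lra.
  by move=> *; split; lra.
- exact: vert_axis.
- move=> k z kn /edgeE ek; apply/not_interior.
  have : frontier P z by rewrite frontE; exists (cyc k).
  by case.
- move=> z Pz /(frontier_outer Pz); rewrite frontE => -[i _].
  by rewrite -(cyc_ord i) => /edgeE ei; exists i.
- move=> a b y ab h; apply: (@path_const (fun t => (t, y))) => //.
  exact: pair_continuousl.
- move=> a b x ab h; apply: (@path_const (fun t => (x, t))) => //.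
  exact: pair_continuousr.
- move=> k l z kn ln /edgeE ek /edgeE el.
  have key i j : edge v i z -> edge v j z -> j = ordS i -> z = v (ordS i).
    by move=> ei ej e; rewrite e in ej; have : (edge v i `&` edge v (ordS i)) z by []; rewrite adjE.
  have [e|ne] := eqVneq (cyc l) (cyc k).
    by apply: Or31; have := congr1 val e; rewrite /= !modn_small.
  have [e|ne1] := eqVneq (cyc l) (ordS (cyc k)).
    apply: Or32; split; first by rewrite /vert -ordS_cyc; exact: key el e.
    by rewrite /vert -!ordS_cyc e.
  have [e|ne2] := eqVneq (cyc k) (ordS (cyc l)).
    apply: Or33; split; first by rewrite /vert e; exact: key ek e.
    by rewrite /vert -!ordS_cyc e.
  have : (edge v (cyc k) `&` edge v (cyc l)) z by [].
  by rewrite disj.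
- move=> k e1 e2; apply: (turn (cyc k)).
  by rewrite /collinear !ordS_cyc -/(vert k) -/(vert k.+1) -/(vert k.+2) -e2 -e1; ring.
- move=> k e1 e2; apply: (turn (cyc k)).
  by rewrite /collinear !ordS_cyc -/(vert k) -/(vert k.+1) -/(vert k.+2) -e2 -e1; ring.
Qed.

Definition vert_x := sort <=%R (undup [seq (v i).1 | i <- enum 'I_n]).
Definition vert_y := sort <=%R (undup [seq (v i).2 | i <- enum 'I_n]).

Lemma vert_x_sorted : sorted <%R vert_x.
Proof. by rewrite sort_lt_sorted undup_uniq. Qed.

Lemma vert_y_sorted : sorted <%R vert_y.
Proof. by rewrite sort_lt_sorted undup_uniq. Qed.

Lemma vert_in_x k : (vert k).1 \in vert_x.
Proof. by rewrite mem_sort mem_undup; apply: map_f; rewrite mem_enum. Qed.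

Lemma vert_in_y k : (vert k).2 \in vert_y.
Proof. by rewrite mem_sort mem_undup; apply: map_f; rewrite mem_enum. Qed.

Lemma size_vert : (size vert_x <= n)%N /\ (size vert_y <= n)%N.
Proof.
by split; rewrite size_sort (leq_trans (size_undup _)) // size_map size_enum_ord.
Qed.

Let M := grid P vert_x vert_y.
Let ph := Phi vert_x vert_y.

(** By [grid_conn_local], being joined to the cell of [z] is a locally constant property on [P], and
    [P] is connected. *)
Lemma polygon_grid_conn c d : M c -> M d -> conn M c d.
Proof.
case=> z Pz <- [w Pw <-].
have loc := grid_conn_local polygon_region vert_x_sorted vert_y_sorted vert_in_x vert_in_y.
pose A := [set u | P u -> conn M (ph z) (ph u)].
pose B := [set u | P u -> ~ conn M (ph z) (ph u)].
have cA : forall u, P u -> conn M (ph z) (ph u) -> A^° u.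
  move=> u Pu cu; have [e e0 he] := loc u Pu; apply/nbhs_box; exists e => // t bt Pt.
  by apply: conn_trans cu _; apply: conn_sym; exact: he.
have cB : forall u, P u -> ~ conn M (ph z) (ph u) -> B^° u.
  move=> u Pu cu; have [e e0 he] := loc u Pu; apply/nbhs_box; exists e => // t bt Pt ct.
  by apply: cu; apply: conn_trans ct _; exact: he.
have E : P `&` A = P.
  apply: Pconnected.
  - by exists z; split=> // _; apply: conn_refl; exists z.
  - exists (A^°); first exact: open_interior.
    apply/seteqP; split=> u [Pu Au]; split=> //; first by apply: cA => //; exact: Au.
    exact: interior_subset Au.
  - exists (~` B^°); first exact/open_closedC/open_interior.
    apply/seteqP; split=> u [Pu Au]; split=> //.
      by move=> /interior_subset Bu; apply: (Bu Pu); exact: Au.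
    by move=> _; apply: contrapT => /(cB _ Pu).
by have : (P `&` A) w; [rewrite E | case=> _; exact].
Qed.

(** [phi] is monotone and skips no value, so a rectangle meets exactly the cells whose indices lie
    between those of its corners. *)
Lemma polygon_rvisible z w : P w -> rvisible P z w <-> rvis M (ph z) (ph w).
Proof.
move=> Pw.
have inv := phi_inv polygon_region vert_x_sorted vert_y_sorted vert_in_x vert_in_y.
have ivt (s : seq R) a b i : sorted <%R s -> s != [::] -> btw (phi s a) (phi s b) i ->
    exists2 x, phi s x = i & Num.min a b <= x <= Num.max a b.
  move=> ss s0; have H c d : c <= d -> (phi s c <= i <= phi s d)%N ->
      exists2 x, phi s x = i & c <= x <= d.
    by move=> cd h; have [x [h1 h2 h3]] := phi_ivt ss s0 cd h; exists x => //; rewrite h1.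
  case: (leP a b) => ab; rewrite /btw => /orP[] h.
  - exact: H.
  - by apply: H => //; have := phi_mono ss ab; lia.
  - by apply: H; [exact: ltW | have := phi_mono ss (ltW ab); lia].
  - by apply: H => //; exact: ltW.
have btwphi (s : seq R) a b x : sorted <%R s -> Num.min a b <= x <= Num.max a b ->
    btw (phi s a) (phi s b) (phi s x).
  by move=> ss; case: (leP a b) => ab /andP[h1 h2]; apply/orP; [left|right]; rewrite !phi_mono.
split=> [vis i j hi hj|vis u [h1 h2]].
  have [|x ex hx] := ivt _ _ _ _ vert_x_sorted _ hi.
    by apply/eqP => e; have := vert_in_x 0; rewrite e.
  have [|y ey hy] := ivt _ _ _ _ vert_y_sorted _ hj.
    by apply/eqP => e; have := vert_in_y 0; rewrite e.
  exists (x, y); last by rewrite /Phi /= ex ey.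
  exact: vis.
have [t Pt et] := vis _ _ (btwphi _ _ _ _ vert_x_sorted h1) (btwphi _ _ _ _ vert_y_sorted h2).
exact: inv et Pt.
Qed.

Lemma polygon_color_bound : exists2 S, guard_set P S &
  colorable P S (6 * colours (maxn (size vert_x) (size vert_y)).*2.+1 + 1).
Proof.
have rg := polygon_region.
set N := (maxn _ _).*2.+1.
have gc : grid_chain n (ph \o vert) M.
  exact: region_grid_chain rg vert_x_sorted vert_y_sorted vert_in_x vert_in_y.
have bM : bounded N M.
  exact: grid_bounded rg vert_x_sorted vert_y_sorted vert_in_x vert_in_y.
have bM' : bounded N (M \o swap) by move=> c /bM[].
have sM : sepH M := grid_chain_sepH gc bM.
have sM' : sepH (M \o swap) := grid_chain_sepH (grid_chain_swap gc) bM'.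
have P0 : P (vert 0).
  have : frontier P (vert 0).
    rewrite frontE; exists (cyc 0) => //; exists 0; split=> //.
    by rewrite /vert; case: (v _) => a b; rewrite /=; congr pair; ring.
  by case=> + _; rewrite -(closure_id _).1 //; exact: Pclosed.
have M0 : M (ph (vert 0)) by exists (vert 0).
have [g [col [gP colP]]] := layered_guards sM sM' bM polygon_grid_conn M0.
have /choice[psi psiP] c : exists z, M c -> P z /\ ph z = c.
  have [[z Pz e]|nM] := pselect (M c); first by exists z.
  by exists (vert 0).
pose S := psi @` (g @` M).
have SP s : S s -> exists p, M p /\ psi (g p) = s.
  by case=> _ [p Mp <-] <-; exists p.
(* [col] colours served cells, not guards, so each guard selects one cell that it serves and takes
   its colour. *)
have /choice[h hP] s : exists p, S s -> M p /\ psi (g p) = s.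
  have [/SP[p hp]|nS] := pselect (S s); first by exists p.
  by exists (0%N, 0%N).
exists S.
  split.
  - apply/finite_image/finite_image.
    apply: (@sub_finite_set _ _ (`I_N `*` `I_N)); last by apply: finite_setX; exact: finite_II.
    by move=> c /bM[].
  - move=> s /SP[p [Mp <-]]; have [Mg _ _] := gP p Mp.
    by have [] := psiP _ Mg.
  - apply/seteqP; split=> [z [s _ []]//|z Pz].
    have Mz : M (ph z) by exists z.
    have [Mg vis _] := gP _ Mz; have [Ps es] := psiP _ Mg.
    exists (psi (g (ph z))); first by exists (g (ph z)) => //; exists (ph z).
    by split=> //; apply/polygon_rvisible => //; rewrite es.
exists (col \o h); split=> [s /hP[Mp _]|s t Ss St [st [q [[Pq vs] [_ vt]]]] /= ec].
  by have [_ _] := gP _ Mp.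
apply: st; have [Mp es] := hP s Ss; have [Mp' et] := hP t St.
have [Mg _ _] := gP _ Mp; have [Mg' _ _] := gP _ Mp'.
have [_ e1] := psiP _ Mg; have [_ e2] := psiP _ Mg'.
rewrite es in e1; rewrite et in e2.
rewrite -es -et; congr psi; apply: (colP _ _ (ph q)) => //.
  by rewrite -e1; exact: (polygon_rvisible s Pq).1 vs.
by rewrite -e2; exact: (polygon_rvisible t Pq).1 vt.
Qed.
End Polygon.

(** * The logarithmic upper bound *)

Lemma chi_rec_le (R : realType) (P S : set (R * R)) k :
  guard_set P S -> colorable P S k -> (chi_rec P <= k%:R%:E)%E.
Proof.
move=> gS cS; apply: (@le_trans _ _ (color_number P S)).
  by apply: ereal_inf_lbound; exists S.
by apply: ereal_inf_lbound; exists k.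
Qed.

Lemma chi_rec_upper (R : realType) : exists C : R, 0 < C /\
    forall (n : nat) (P : set (R * R)), (4 <= n)%N ->
      orthogonal_polygon n P -> (chi_rec P <= (C * ln n%:R)%:E)%E.
Proof.
have l2 : 0 < ln 2 :> R by rewrite ln_gt0 // ltr1n.
(* [31 = 6 * 4 + 7]: at most [6 * (t + 1) + 1] colours are used, where [t * ln 2 <= 4 * ln n], and
   [ln 2 <= ln n] absorbs the 7. *)
exists (31 / ln 2); split=> [|n P n4 [cP conP regP [v [sv ov fv]]]]; first by rewrite divr_gt0.
have [S gS cS] := polygon_color_bound cP conP regP sv ov fv.
apply: le_trans (chi_rec_le gS cS) _; rewrite lee_fin.
have [s1 s2] := size_vert v.
(* The number of cells is at most [(2 * n + 1) ^ 2], and [2 * n + 1 <= n * n]. *)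
set t := trunc_log 2 (n ^ 4).
have n0 : 0 < n%:R :> R by rewrite ltr0n; lia.
have ht : (colours (maxn (size (vert_x v)) (size (vert_y v))).*2.+1 <= t.+1)%N.
  rewrite /colours ltnS; apply: leq_trunc_log.
  set m := (maxn _ _); have hm : (m <= n)%N by rewrite geq_max s1 s2.
  have h1 : (m.*2.+1 <= n * n)%N by nia.
  by rewrite (_ : n ^ 4 = (n * n) * (n * n))%N ?leq_mul //; rewrite !expnS expn0; lia.
have t4 : t%:R * ln 2 <= 4 * ln n%:R :> R.
  have /(trunc_logP (isT : (1 < 2)%N)) : (0 < n ^ 4)%N by rewrite expn_gt0; lia.
  rewrite -/t -(ler_nat R) !natrX => h.
  have : ln (2 ^+ t) <= ln (n%:R ^+ 4) :> R by rewrite ler_ln // posrE exprn_gt0.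
  by rewrite !lnXn // -[ln 2 *+ t]mulr_natl -[ln n%:R *+ 4]mulr_natl.
have n2 : ln 2 <= ln n%:R :> R by rewrite ler_ln ?posrE ?ltr0n ?ler_nat //; lia.
apply: (@le_trans _ _ (6 * (t%:R + 1) + 1)).
  by rewrite natr1 -natrM natr1 ler_nat; lia.
rewrite mulrAC ler_pdivlMr // (_ : _ * ln 2 = 6 * (t%:R * ln 2) + 7 * ln 2); last by ring.
by move: t4 n2; clear; lra.
Qed.

(** * Histograms *)

Lemma column_uniq (R : realType) (i j : nat) (x : R) : i%:R < x < i.+1%:R -> j%:R <= x <= j.+1%:R -> i = j.
Proof.
move=> /andP[h1 h2] /andP[h3 h4].
have : (i < j.+1)%N by rewrite -(ltr_nat R); exact: lt_le_trans h1 h4.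
have : (j < i.+1)%N by rewrite -(ltr_nat R); exact: le_lt_trans h3 h2.
lia.
Qed.

Lemma nat_floor (R : realType) (i j : nat) (x : R) : (i < j)%N -> i%:R <= x <= j%:R ->
  exists k, (i <= k < j)%N /\ k%:R <= x <= k.+1%:R.
Proof.
elim: j => // j IH ij /andP[h1 h2].
have [h|h] := leP j%:R x; first by exists j; rewrite h h2; split=> //; lia.
have [e|ij'] : i = j \/ (i < j)%N by lia.
  by move: h1; rewrite e; lra.
have [|k [k1 k2]] := IH ij'; first by rewrite h1 ltW.
by exists k; split=> //; lia.
Qed.

Lemma near_inside (R : realType) (a b x e : R) : a < b -> a <= x <= b -> 0 < e ->
  exists y, [/\ `|y - x| < e, a < y & y < b].
Proof.
move=> ab /andP[ax xb] e0; have [h|h] := leP x ((a + b) / 2).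
  exists (x + Num.min e (b - a) / 4).
  have : Num.min e (b - a) <= e by rewrite ge_min lexx.
  have : Num.min e (b - a) <= b - a by rewrite ge_min lexx orbT.
  have : 0 < Num.min e (b - a) by rewrite lt_min e0 subr_gt0.
  by move: (Num.min _ _) => d *; split; rewrite ?ltr_norml; lra.
exists (x - Num.min e (b - a) / 4).
have : Num.min e (b - a) <= e by rewrite ge_min lexx.
have : Num.min e (b - a) <= b - a by rewrite ge_min lexx orbT.
have : 0 < Num.min e (b - a) by rewrite lt_min e0 subr_gt0.
by move: (Num.min _ _) => d *; split; rewrite ?ltr_norml; lra.
Qed.

Section Histogram.
Variables (R : realType) (m : nat) (H : nat -> nat).
Hypothesis m_gt0 : (0 < m)%N.
Hypothesis H0 : H 0 = 0%N.
Hypothesis Hm : H m.+1 = 0%N.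
Hypothesis H_gt0 : forall j, (0 < j <= m)%N -> (0 < H j)%N.
Hypothesis H_neq : forall j, (j <= m)%N -> H j != H j.+1.

(** The shift leaves [H 0] and [H m.+1] for the zero heights outside, so every vertical edge, the
    outermost included, joins heights [H i] and [H i.+1] at abscissa [i]. *)
Definition column i : set (R * R) := `[i%:R, i.+1%:R] `*` `[0, (H i.+1)%:R].

Definition histogram : set (R * R) := \bigcup_(i in `I_m) column i.

Lemma columnE i z :
  column i z <-> i%:R <= z.1 <= i.+1%:R /\ 0 <= z.2 <= (H i.+1)%:R.
Proof. by rewrite /column /setX /= !in_itv. Qed.

Lemma histogramE z : histogram z <-> exists i, [/\ (i < m)%N, i%:R <= z.1 <= i.+1%:R
   & 0 <= z.2 <= (H i.+1)%:R].
Proof.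
split=> [[i /= im /columnE[h1 h2]]|[i [im h1 h2]]]; first by exists i.
by exists i => //; apply/columnE.
Qed.

Lemma histogram_compact : compact histogram.
Proof.
rewrite /histogram bigcup_mkord; apply: bigsetU_compact => i _.
by apply: compact_setX; exact: segment_compact.
Qed.

Lemma histogram_closed : closed histogram.
Proof. by apply: compact_closed histogram_compact; exact: norm_hausdorff. Qed.

Lemma histogram_base (x : R) : 0 <= x <= m%:R -> histogram (x, 0).
Proof.
move=> h; have [k [k1 k2]] := nat_floor m_gt0 h; apply/histogramE; exists k; split=> //=.
by rewrite lexx ler0n.
Qed.

Lemma histogram_range z : histogram z -> 0 <= z.1 <= m%:R.
Proof.
move=> /histogramE[i [im /andP[h1 h2] _]].
rewrite (le_trans _ h1) ?ler0n // (le_trans h2) // ler_nat; lia.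
Qed.

(** Each point drops vertically onto the base; all these segments, each united with the base, share
    the origin. *)
Lemma histogram_connected : connected histogram.
Proof.
pose base := [set (x, 0 : R) | x in `[0 : R, m%:R]].
pose A (z : R * R) := [set (z.1, t) | t in `[0, z.2]] `|` base.
have -> : histogram = \bigcup_(z in histogram) A z.
  apply/seteqP; split=> [z hz|w [z hz [[t]|[x]]]].
  - exists z => //; left; exists z.2; last by case: z {hz}.
    by move/histogramE: hz => [i [_ _ /andP[h _]]]; rewrite /= in_itv /= h lexx.
  - rewrite /= in_itv /= => /andP[t0 tz] <-; move/histogramE: hz => [i [im h1 /andP[_ h2]]].
    by apply/histogramE; exists i; split=> //=; rewrite t0 (le_trans tz h2).
  - by rewrite /= in_itv /= => h <-; exact: histogram_base.
apply: bigcup_connected.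
  exists (0, 0) => z _; right; exists 0 => //=.
  by rewrite in_itv /= lexx ler0n.
move=> z hz; apply: connectedU.
- exists (z.1, 0); split.
    exists 0 => //=; rewrite in_itv /= lexx /=.
    by move/histogramE: hz => [i [_ _ /andP[]]].
  by exists z.1 => //=; rewrite in_itv /= histogram_range.
- apply: connected_continuous_connected; first exact: segment_connected.
  by apply: continuous_subspaceT; exact: pair_continuousr.
- apply: connected_continuous_connected; first exact: segment_connected.
  by apply: continuous_subspaceT; exact: pair_continuousl.
Qed.

Lemma column_interior i z : (i < m)%N ->
  i%:R < z.1 < i.+1%:R -> 0 < z.2 < (H i.+1)%:R -> histogram^° z.
Proof.
move=> im /andP[a1 a2] /andP[b1 b2]; apply/nbhs_box.
pose e := Num.min (Num.min (z.1 - i%:R) (i.+1%:R - z.1)) (Num.min z.2 ((H i.+1)%:R - z.2)).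
exists e; first by rewrite !lt_min !subr_gt0 a1 a2 b1 b2.
move=> w; rewrite /box /e !lt_min => -[/andP[/andP[c1 c2] _] /andP[_ /andP[c3 c4]]].
apply/histogramE; exists i; split=> //.
  by move: c1 c2; rewrite !ltr_norml => *; apply/andP; split; lra.
by move: c3 c4; rewrite !ltr_norml => *; apply/andP; split; lra.
Qed.

Lemma histogram_regclosed : regclosed histogram.
Proof.
apply/seteqP; split.
  apply: subset_trans (closure_subset (@interior_subset _ histogram)) _.
  by rewrite -(closure_id _).1 //; exact: histogram_closed.
move=> z /histogramE[i [im h1 h2]] B /nbhs_box[e e0 he].
have [|x [x1 x2 x3]] := near_inside _ h1 e0; first by rewrite ltr_nat.
have [|y [y1 y2 y3]] := near_inside _ h2 e0; first by rewrite ltr0n; apply: H_gt0; lia.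
exists (x, y); split; last exact: he.
by apply: (@column_interior i) => //=; apply/andP.
Qed.

(** Vertices [2 * i] and [2 * i + 1] are the ends [(i, H i)] and [(i, H i.+1)] of the vertical edge
    at abscissa [i]; [uphalf] gives both heights by one formula. The last edge is the base. *)
Definition hvert k : R * R :=
  let r := (k %% (2 * m + 2))%N in (r./2%:R, (H (uphalf r))%:R).

Lemma hvert_even i : (i <= m)%N -> hvert (2 * i) = (i%:R, (H i)%:R).
Proof. by move=> im; rewrite /hvert modn_small ?uphalfE; last lia; congr (_%:R, (H _)%:R); lia. Qed.

Lemma hvert_odd i : (i <= m)%N -> hvert (2 * i + 1) = (i%:R, (H i.+1)%:R).
Proof. by move=> im; rewrite /hvert modn_small ?uphalfE; last lia; congr (_%:R, (H _)%:R); lia. Qed.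

Lemma hvert_mod k : hvert (k %% (2 * m + 2)) = hvert k.
Proof. by rewrite /hvert modn_mod. Qed.

Definition hedge k (z : R * R) : Prop :=
  if k == (2 * m + 1)%N then z.2 = 0 /\ 0 <= z.1 <= m%:R
  else if odd k then z.2 = (H k./2.+1)%:R /\ k./2%:R <= z.1 <= k./2.+1%:R
  else z.1 = k./2%:R /\ between (H k./2)%:R (H k./2.+1)%:R z.2.

Lemma hedge_even i z : hedge (2 * i) z <-> z.1 = i%:R /\ between (H i)%:R (H i.+1)%:R z.2.
Proof.
have e1 : (2 * i == 2 * m + 1)%N = false by clear; lia.
have e2 : odd (2 * i) = false by clear; lia.
have e3 : (2 * i)./2 = i by clear; lia.
by rewrite /hedge e1 e2 e3.
Qed.

Lemma hedge_odd i z : (i < m)%N ->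
  hedge (2 * i + 1) z <-> z.2 = (H i.+1)%:R /\ i%:R <= z.1 <= i.+1%:R.
Proof.
move=> im; have e1 : (2 * i + 1 == 2 * m + 1)%N = false by clear -im; lia.
have e2 : odd (2 * i + 1) = true by clear; lia.
have e3 : (2 * i + 1)./2 = i by clear; lia.
by rewrite /hedge e1 e2 e3.
Qed.

Lemma hedge_last z : hedge (2 * m + 1) z <-> z.2 = 0 /\ 0 <= z.1 <= m%:R.
Proof. by rewrite /hedge eqxx. Qed.

Lemma index_cases k : (k < 2 * m + 2)%N ->
  [\/ exists2 i, (i <= m)%N & k = (2 * i)%N, exists2 i, (i < m)%N & k = (2 * i + 1)%N
    | k = (2 * m + 1)%N].
Proof.
move=> hk; have [ok|ek] := boolP (odd k).
  have [->|ne] := eqVneq k (2 * m + 1)%N; first exact: Or33.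
  by apply: Or32; exists k./2; lia.
by apply: Or31; exists k./2; lia.
Qed.

Lemma hvert_last : hvert (2 * m + 2) = (0, 0).
Proof. by rewrite -hvert_mod modnn -(muln0 2) hvert_even // H0. Qed.

Lemma hvert_wrap : hvert (2 * m + 3) = (0, (H 1)%:R).
Proof.
by rewrite -hvert_mod (_ : 2 * m + 3 = 2 * m + 2 + (2 * 0 + 1))%N ?modnDl ?modn_small ?hvert_odd //; lia.
Qed.

Lemma segment_hedge k z : (k < 2 * m + 2)%N ->
  segment (hvert k) (hvert k.+1) z <-> hedge k z.
Proof.
case/index_cases => [[i im ->]|[i im ->]|->].
- rewrite -[(2 * i).+1]addn1 hvert_even // hvert_odd // segment_axis /=; last by left.
  rewrite hedge_even; split=> [[[_ h1 h2]//|[h0 h1]]|[h1 h2]]; last by left.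
  rewrite /between -!eq_le => /orP[] /eqP <-; split=> //; rewrite h1 -h0 ?lexx //.
- rewrite (_ : (2 * i + 1).+1 = 2 * i.+1)%N; last lia.
  rewrite hvert_even // hvert_odd ?(ltnW im) // segment_axis /=; last by right.
  rewrite hedge_odd //; split=> [[[h0 h1 h2]|[_ h1 h2]]|[h1 h2]].
  + by move/eqP: h0; rewrite eqr_nat; lia.
  + split=> //; move: h2; rewrite /between => /orP[//|/andP[h2 h3]].
    by have := le_trans h2 h3; rewrite ler_nat ltnn.
  + by right; split=> //; rewrite /between h2.
- rewrite (_ : (2 * m + 1).+1 = 2 * m + 2)%N; last lia.
  rewrite hvert_last hvert_odd // Hm segment_axis /=; last by right.
  rewrite hedge_last; split=> [[[h0 h1 h2]|[_ h1 h2]]|[h1 h2]].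
  + by move/eqP: h0; rewrite pnatr_eq0; lia.
  + split=> //; move: h2; rewrite /between => /orP[/andP[h2 h3]|//].
    by have := le_trans h2 h3; rewrite lern0; lia.
  + by right; split=> //; rewrite /between h2 orbT.
Qed.

Definition hpoly (i : 'I_(2 * m + 2)) := hvert i.

Lemma hpoly_ordS i : hpoly (ordS i) = hvert i.+1.
Proof. by rewrite /hpoly /= hvert_mod. Qed.

Lemma edge_hedge i z : edge hpoly i z <-> hedge i z.
Proof. by rewrite /edge hpoly_ordS; apply: segment_hedge. Qed.

Lemma hpoly_ordSS i : hpoly (ordS (ordS i)) = hvert i.+2.
Proof. by rewrite hpoly_ordS /= -hvert_mod -addn1 modnDml addn1 hvert_mod. Qed.

Lemma hpoly_turn i : ~ collinear (hpoly i) (hpoly (ordS i)) (hpoly (ordS (ordS i))).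
Proof.
rewrite hpoly_ordSS hpoly_ordS /hpoly /collinear.
have [[j jm ->]|[j jm ->]|->] := index_cases (ltn_ord i).
- rewrite -[(2 * j).+2]addn2 -[(2 * j).+1]addn1 hvert_even // hvert_odd //.
  have nH := H_neq jm; rewrite -(eqr_nat R) eq_sym -subr_eq0 in nH.
  have [e|ltm] : j = m \/ (j < m)%N by lia.
    rewrite e hvert_last /= => /esym/eqP; rewrite subrr mul0r mulf_eq0 -e (negbTE nH) /=.
    by rewrite sub0r oppr_eq0 pnatr_eq0; lia.
  rewrite (_ : 2 * j + 2 = 2 * j.+1)%N ?hvert_even //=; last lia.
  by rewrite subrr mul0r -natr1 addrAC subrr add0r mulr1 => /esym/eqP; rewrite (negbTE nH).
- rewrite (_ : (2 * j + 1).+2 = 2 * j.+1 + 1)%N; last lia.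
  rewrite (_ : (2 * j + 1).+1 = 2 * j.+1)%N; last lia.
  rewrite hvert_even // !hvert_odd // 1?ltnW //=.
  have nH := H_neq jm; rewrite -(eqr_nat R) eq_sym -subr_eq0 in nH.
  by rewrite !subrr -natr1 addrAC subrr add0r mul1r mul0r => /eqP; rewrite (negbTE nH).
- rewrite (_ : (2 * m + 1).+2 = 2 * m + 3)%N; last lia.
  rewrite (_ : (2 * m + 1).+1 = 2 * m + 2)%N; last lia.
  rewrite hvert_last hvert_wrap hvert_odd //= Hm !subrr mul0r subr0 sub0r => /eqP.
  rewrite mulf_eq0 oppr_eq0 !pnatr_eq0.
  by have := H_gt0 (j := 1); rewrite m_gt0 => /(_ isT); lia.
Qed.

Lemma hedge_start k : (k < 2 * m + 2)%N -> hedge k (hvert k).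
Proof.
move=> hk; apply/segment_hedge => //; exists 0; split=> //.
by rewrite [LHS]surjective_pairing; congr pair; ring.
Qed.

Lemma hedge_end k : (k < 2 * m + 2)%N -> hedge k (hvert k.+1).
Proof.
move=> hk; apply/segment_hedge => //; exists 1; split=> //.
by rewrite [LHS]surjective_pairing; congr pair; ring.
Qed.

Lemma hpoly_adj i : edge hpoly i `&` edge hpoly (ordS i) = [set hpoly (ordS i)].
Proof.
apply/seteqP; split=> [z [/edge_hedge e1 /edge_hedge e2]|z ->] /=; last first.
  split; apply/edge_hedge; last exact: hedge_start.
  by rewrite hpoly_ordS; apply: hedge_end.
rewrite hpoly_ordS; move: e1 e2; rewrite /=.
have [[j jm ->]|[j jm ->]|->] := index_cases (ltn_ord i).
- move=> /hedge_even[e1 _]; have [e|ltm] : j = m \/ (j < m)%N by lia.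
    rewrite e -addn1 modn_small ?hvert_odd // => [/hedge_last[e2 _]|]; last lia.
    by rewrite [z]surjective_pairing e1 e2 e Hm.
  rewrite -addn1 modn_small ?hvert_odd // => [/(hedge_odd _ ltm)[e2 _]|]; last lia.
  by rewrite [z]surjective_pairing e1 e2.
- move=> /(hedge_odd _ jm)[e1 _].
  rewrite (_ : (2 * j + 1).+1 = 2 * j.+1)%N; last lia.
  rewrite modn_small ?hvert_even // => [/hedge_even[e2 _]|]; last lia.
  by rewrite [z]surjective_pairing e1 e2.
- move=> /hedge_last[e1 _].
  rewrite (_ : (2 * m + 1).+1 = 2 * m + 2)%N; last lia.
  rewrite modnn hvert_last -(muln0 2) => /hedge_even[e2 _].
  by rewrite [z]surjective_pairing e1 e2.
Qed.

Lemma hedge_disj k l z : (k < l)%N -> (l < 2 * m + 2)%N -> l <> k.+1 ->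
  ~ (k = 0%N /\ l = (2 * m + 1)%N) -> hedge k z -> hedge l z -> False.
Proof.
move=> kl ln n1 n2; have kn := ltn_trans kl ln.
have nat_le a b : a%:R <= z.1 -> z.1 <= b%:R -> (a <= b)%N.
  by move=> h1 h2; rewrite -(ler_nat R); exact: le_trans h1 h2.
have [[i im ek]|[i im ek]|ek] := index_cases kn; have [[j jm el]|[j jm el]|el] := index_cases ln;
  rewrite ek el in kl n1 n2 *.
- move=> /hedge_even[e1 _] /hedge_even[e2 _].
  by move/eqP: e2; rewrite e1 eqr_nat; lia.
- move=> /hedge_even[e _] /(hedge_odd _ jm)[_]; rewrite e !ler_nat; lia.
- move=> /hedge_even[_ b] /hedge_last[e _]; move: b; rewrite e /between !lern0 !ler0n /= andbT.
  have := @H_gt0 i; have := @H_gt0 i.+1; lia.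
- move=> /(hedge_odd _ im)[_ h] /hedge_even[e _]; move: h; rewrite e !ler_nat; lia.
- move=> /(hedge_odd _ im)[e1 /andP[h1 h2]] /(hedge_odd _ jm)[e2 /andP[h3 h4]].
  have ij := nat_le _ _ h3 h2; have ej : j = i.+1 by lia.
  move/eqP: e1; rewrite e2 eqr_nat ej eq_sym; apply/negP/H_neq; lia.
- move=> /(hedge_odd _ im)[e1 _] /hedge_last[/eqP + _]; rewrite e1 pnatr_eq0.
  have := @H_gt0 i.+1; lia.
- lia.
- lia.
- lia.
Qed.

Lemma hpoly_disj i j : j != i -> j != ordS i -> i != ordS j ->
  edge hpoly i `&` edge hpoly j = set0.
Proof.
wlog ij : i j / (i < j)%N.
  move=> W n1 n2 n3; have [lt|gt|/val_inj e] := ltngtP i j; first exact: W.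
    by rewrite setIC; apply: W => //; rewrite eq_sym.
  by rewrite e eqxx in n1.
move=> _ /eqP n2 /eqP n3; rewrite -subset0 => z [/edge_hedge e1 /edge_hedge e2] /=.
apply: (hedge_disj ij (ltn_ord j)) e1 e2 => [e|[e e']].
  by apply: n2; apply: val_inj; rewrite /= modn_small -e.
apply: n3; apply: val_inj; rewrite /= e e' (_ : (2 * m + 1).+1 = 2 * m + 2)%N ?modnn //.
by clear; lia.
Qed.

Lemma hedge_outer k z : (k < 2 * m + 2)%N -> hedge k z -> ~ histogram^° z.
Proof.
move=> /index_cases hk ek /nbhs_box[e e0 he].
have sub (w : R * R) : `|w.1 - z.1| < e -> `|w.2 - z.2| < e -> histogram w by move=> h1 h2; apply: he.
pose d := Num.min e 1 / 2.
have [d0 de d1] : [/\ 0 < d, d < e & d < 1].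
  have : Num.min e 1 <= e by rewrite ge_min lexx.
  have : Num.min e 1 <= 1 by rewrite ge_min lexx orbT.
  have : 0 < Num.min e 1 by rewrite lt_min e0 ltr01.
  by rewrite /d; move: (Num.min _ _) => c *; split; lra.
case: hk => [[i im e1]|[i im e1]|e1]; rewrite e1 in ek.
- move/hedge_even: ek => [ez bt].
  (* A point outside is found by moving sideways to the lower neighbouring column, and also upwards
     in case the given point is level with its top. *)
  have [lt|gt] := ltnP (H i) (H i.+1).
    have /histogramE[j [jm c1 /andP[_ c2]]] : histogram (z.1 - d, z.2 + d).
      by apply: sub; rewrite /= ltr_norml; lra.
    rewrite /= ez in c1 c2.
    case: i => [|i] in im e1 ez bt lt c1 *.
      by have := ler0n R j; move: c1 => /andP[]; lra.
    have eij : i = j by apply: (column_uniq (x := i.+1%:R - d)) => //; rewrite -!natr1; lra.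
    rewrite -eij in c2; have : (H i.+1)%:R <= (H i.+2)%:R :> R by rewrite ler_nat ltnW.
    by move: bt; rewrite /between => /orP[] /andP[]; lra.
  have /histogramE[j [jm c1 /andP[_ c2]]] : histogram (z.1 + d, z.2 + d).
    by apply: sub; rewrite /= ltr_norml; lra.
  rewrite /= ez in c1 c2.
  have eij : i = j by apply: (column_uniq (x := i%:R + d)) => //; rewrite -!natr1; lra.
  rewrite -eij in c2; have : (H i.+1)%:R <= (H i)%:R :> R by rewrite ler_nat.
  by move: bt; rewrite /between => /orP[] /andP[]; lra.
- move/(hedge_odd _ im): ek => [ez bt].
  have [|x [x1 x2 x3]] := near_inside _ bt e0; first by rewrite ltr_nat.
  have /histogramE[j [jm c1 /andP[_ c2]]] : histogram (x, z.2 + d).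
    by apply: sub => //=; rewrite ltr_norml; lra.
  have eij : i = j by apply: column_uniq c1; rewrite /= x2.
  by rewrite /= ez -eij in c2; lra.
- move/hedge_last: ek => [ez _].
  have /histogramE[j [jm _ /andP[c2 _]]] : histogram (z.1, z.2 - d).
    by apply: sub; rewrite /= ltr_norml; lra.
  by rewrite /= ez in c2; lra.
Qed.

Lemma hedge_histogram k z : (k < 2 * m + 2)%N -> hedge k z -> histogram z.
Proof.
case/index_cases => [[i im ->]|[i im ->]|->].
- move/hedge_even => [ez bt]; have z0 : 0 <= z.2.
    by move: bt (ler0n R (H i)) (ler0n R (H i.+1)); rewrite /between => /orP[] /andP[]; lra.
  apply/histogramE; have [lt|gt] := ltnP (H i) (H i.+1).
    have im' : (i < m)%N.
      by rewrite ltnNge; apply/negP => mi; move: lt; rewrite (_ : i = m) ?Hm //; lia.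
    exists i; rewrite ez z0 lexx -natr1; split=> //; first by lra.
    have : (H i)%:R <= (H i.+1)%:R :> R by rewrite ler_nat ltnW.
    by move: bt; rewrite /between => /orP[] /andP[]; lra.
  case: i => [|i] in im ez bt gt *.
    by move: gt; rewrite H0; have := @H_gt0 1; rewrite m_gt0 => /(_ isT); lia.
  exists i; rewrite ez z0 lexx -natr1; split=> //; first by lra.
  have : (H i.+2)%:R <= (H i.+1)%:R :> R by rewrite ler_nat.
  by move: bt; rewrite /between => /orP[] /andP[]; lra.
- by move/(hedge_odd _ im) => [ez bt]; apply/histogramE; exists i; rewrite ez ler0n lexx.
- by move/hedge_last => [ez bt]; have := histogram_base bt; rewrite -ez -surjective_pairing.
Qed.

Lemma histogram_boundary z : histogram z -> ~ histogram^° z -> exists2 k, (k < 2 * m + 2)%N & hedge k z.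
Proof.
move=> hz ni; apply: contrapT => ne; apply: ni.
have {}ne k : (k < 2 * m + 2)%N -> ~ hedge k z by move=> hk h; apply: ne; exists k.
have [i [im /andP[x1 x2] /andP[y1 y2]]] := (histogramE z).1 hz.
have y0 : 0 < z.2.
  rewrite lt_neqAle y1 andbT eq_sym; apply/eqP => e; apply: (ne (2 * m + 1)%N); first lia.
  by apply/hedge_last; split=> //; exact: histogram_range.
have yH : z.2 < (H i.+1)%:R.
  rewrite lt_neqAle y2 andbT; apply/eqP => e; apply: (ne (2 * i + 1)%N); first lia.
  by apply/hedge_odd => //; rewrite x1.
have vert j : (j <= m)%N -> z.1 = j%:R -> z.2 <= (H j)%:R \/ z.2 <= (H j.+1)%:R ->
    z.2 < (H j)%:R /\ z.2 < (H j.+1)%:R.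
  move=> jm ez h; have := ne (2 * j)%N; rewrite hedge_even /between => n.
  have {}n : ~ between (H j)%:R (H j.+1)%:R z.2 by move=> b; apply: n => //; clear -jm; lia.
  have [h1|h1] := ltP z.2 (H j)%:R; have [h2|h2] := ltP z.2 (H j.+1)%:R; split=> //; exfalso; apply: n;
    rewrite /between ?h1 ?h2 ?(ltW h1) ?(ltW h2) ?orbT //.
  1-2: by case: h => ->; rewrite ?orbT.
(* Common sides of neighbouring columns are interior below both tops: a small square is covered by
   the two columns. *)
have side j : (0 < j < m)%N -> z.1 = j%:R -> z.2 < (H j)%:R -> z.2 < (H j.+1)%:R -> histogram^° z.
  case: j => // j jm ez h1 h2; apply/nbhs_box.
  pose e := Num.min 1 (Num.min z.2 (Num.min ((H j.+1)%:R - z.2) ((H j.+2)%:R - z.2))).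
  exists e; first by rewrite !lt_min !subr_gt0 ltr01 y0 h1 h2.
  move=> w; rewrite /box /e !lt_min ez => -[/andP[c1 _] /andP[_ /and3P[c2 c3 c4]]].
  apply/histogramE; move: c1 c2 c3 c4; rewrite !ltr_norml => /andP[a1 a2] /andP[b1 b2] /andP[_ b3] /andP[_ b4].
  have n1 : j.+1%:R = j%:R + 1 :> R by rewrite natr1.
  have n2 : j.+2%:R = j.+1%:R + 1 :> R by rewrite natr1.
  have yw : 0 <= w.2 by lra.
  have [lt|ge] := leP w.1 j.+1%:R.
    exists j; split; first by clear -jm; lia.
      by apply/andP; split; lra.
    by rewrite yw /=; lra.
  exists j.+1; split; first by clear -jm; lia.
    by apply/andP; split; lra.
  by rewrite yw /=; lra.
have [e|nx1] := eqVneq z.1 i%:R.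
  have [h1 h2] := vert i (ltnW im) e (or_intror y2).
  apply: (side i) => //; rewrite im andbT lt0n; apply/eqP => i0.
  by rewrite i0 H0 in h1; lra.
have [e|nx2] := eqVneq z.1 i.+1%:R.
  have [h1 h2] := vert i.+1 im e (or_introl y2).
  apply: (side i.+1) => //=; rewrite ltn_neqAle im andbT; apply/eqP => i0.
  by rewrite i0 Hm in h2; lra.
apply: (column_interior im); last by rewrite y0.
by rewrite !lt_neqAle x1 x2 nx2 eq_sym nx1.
Qed.

Lemma histogram_polygon : orthogonal_polygon (2 * m + 2) histogram.
Proof.
split; [exact: histogram_compact | exact: histogram_connected | exact: histogram_regclosed |].
exists hpoly; split.
- split; [lia | exact: hpoly_turn | exact: hpoly_adj | exact: hpoly_disj].
- move=> i; rewrite hpoly_ordS /hpoly.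
  have [[j jm ->]|[j jm ->]|->] := index_cases (ltn_ord i).
  + by left; rewrite -[(2 * j).+1]addn1 hvert_even // hvert_odd.
  + right; rewrite (_ : (2 * j + 1).+1 = 2 * j.+1)%N; last lia.
    by rewrite hvert_even // hvert_odd // ltnW.
  + right; rewrite (_ : (2 * m + 1).+1 = 2 * m + 2)%N; last lia.
    by rewrite hvert_last hvert_odd // Hm.
- rewrite /frontier -(closure_id _).1; last exact: histogram_closed.
  apply/seteqP; split=> [z [hz ni]|z [i _ /edge_hedge ei]].
    have [k kn ek] := histogram_boundary hz ni.
    by exists (Ordinal kn) => //; apply/edge_hedge.
  by split; [exact: hedge_histogram ei | exact: hedge_outer ei].
Qed.

End Histogram.

(** * The ruler histogram and its guards *)

Section Ruler.
Variables (R : realType) (d : nat).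
Hypothesis d_gt0 : (0 < d)%N.

(** Odd columns are the highest, with height [d]; the middle one, [j = 2 ^ (d - 1)], is the lowest,
    with height 1. *)
Definition ruler j : nat := if (0 < j < 2 ^ d)%N then (d - logn 2 j)%N else 0%N.

Lemma ruler_ge j k : (0 < j < 2 ^ d)%N -> ~~ (2 ^ k.+1 %| j)%N -> (d - k <= ruler j)%N.
Proof.
move=> hj; rewrite /ruler hj pfactor_dvdn //; last by case/andP: hj.
by rewrite -leqNgt => h; exact: leq_sub2l.
Qed.

Lemma ruler_le j k : (2 ^ k %| j)%N -> (ruler j <= d - k)%N.
Proof.
rewrite /ruler; case: ifP => // /andP[j0 _].
by rewrite pfactor_dvdn // => h; exact: leq_sub2l.
Qed.

Let m := (2 ^ d).-1.

Lemma expn2_gt1 : (1 < 2 ^ d)%N.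
Proof. by rewrite -{1}(expn0 2) ltn_exp2l. Qed.

Lemma columnsS : m.+1 = (2 ^ d)%N.
Proof. by rewrite prednK // (ltn_trans _ expn2_gt1). Qed.

Lemma ruler_gt0 j : (0 < j <= m)%N -> (0 < ruler j)%N.
Proof.
move=> hj; have := columnsS => em; rewrite /ruler ifT; last lia.
rewrite subn_gt0 ltnNge -pfactor_dvdn //; last by case/andP: hj.
apply/negP => /dvdn_leq; lia.
Qed.

Lemma ruler_odd j : odd j -> (j <= m)%N -> ruler j = d.
Proof.
move=> oj jm; have em := columnsS; rewrite /ruler ifT; last lia.
by rewrite lognE /= dvdn2 oj /= andbF subn0.
Qed.

Lemma ruler_even j : ~~ odd j -> (ruler j < d)%N.
Proof.
move=> ej; have h : (2 ^ 1 %| j)%N by rewrite expn1 dvdn2.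
by have := ruler_le h; lia.
Qed.

Lemma ruler_neq j : (j <= m)%N -> ruler j != ruler j.+1.
Proof.
move=> jm; have [oj|ej] := boolP (odd j).
  rewrite (ruler_odd oj jm); have := @ruler_even j.+1; rewrite /= oj => /(_ isT); lia.
have [e|lt] : j = m \/ (j < m)%N by lia.
  have om : odd m by rewrite -[odd m]negbK -oddS columnsS oddX orbF -lt0n d_gt0.
  by rewrite e om in ej.
by rewrite (@ruler_odd j.+1) //=; have := ruler_even ej; lia.
Qed.

Lemma ruler_bound : (0 < m)%N /\ ruler 0 = 0%N /\ ruler m.+1 = 0%N.
Proof.
have := expn2_gt1; have := columnsS; rewrite /ruler => em p1; split; first lia.
by split=> //; rewrite em ltnn andbF.
Qed.

Notation P := (@histogram R m ruler).

(** Column [j] occupies [[j - 1, j]], so these are the columns with [a * 2 ^ k < j < a.+1 * 2 ^ k].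
    For [0 < k <= d] they are all higher than the columns at multiples of [2 ^ k] that bound the
    block. *)
Definition in_block k a (x : R) := (a * 2 ^ k)%:R <= x <= ((a.+1 * 2 ^ k).-1)%:R.

Lemma block_histogram k a x y : (0 < k)%N -> (a.+1 * 2 ^ k <= 2 ^ d)%N -> in_block k a x ->
  0 <= y <= (d - k.-1)%:R -> P (x, y).
Proof.
move=> k0 ak hx /andP[y0 y1].
have k2 : (1 < 2 ^ k)%N by rewrite -{1}(expn0 2) ltn_exp2l.
have [|i [i1 i2]] := nat_floor _ hx; first by rewrite mulSn; lia.
have em := columnsS; apply/histogramE; exists i; split=> //=; first by clear -em i1 ak; lia.
rewrite y0 (le_trans y1) // ler_nat.
have i3 : (a * 2 ^ k < i.+1 < a.+1 * 2 ^ k)%N by clear -i1; lia.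
apply: ruler_ge; first by clear -i3 ak; lia.
rewrite prednK //; apply/negP => /dvdnP[q e]; move: i3; rewrite e !ltn_mul2r.
clear; lia.
Qed.

Lemma outside_low_column j k (x y : R) : (2 ^ k %| j)%N -> j%:R - 1 < x < j%:R -> (d - k)%:R < y -> ~ P (x, y).
Proof.
move=> kj /andP[x1 x2] hy /histogramE[i [im /= h1 /andP[_ h2]]].
case: j => [|j] in kj x1 x2 *.
  by have := ler0n R i; move: h1 => /andP[c _]; lra.
have e : j = i.
  by apply: column_uniq h1; rewrite x2 andbT; move: x1; rewrite -[j.+1%:R]natr1; lra.
rewrite -e in h2; have := ruler_le kj; rewrite -(ler_nat R); lra.
Qed.

(* [s] is the guard that sees the top of the middle column of the block. *)
Lemma block_guard S k a : guard_set P S -> (0 < k)%N -> (a.+1 * 2 ^ k <= 2 ^ d)%N ->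
  exists2 s, S s & in_block k a s.1 /\ s.2 <= (d - k.-1)%:R.
Proof.
move=> [_ SP cov] k0 ak.
have ek : (2 ^ k = 2 * 2 ^ k.-1)%N by rewrite -expnS prednK.
have p0 : (0 < 2 ^ k.-1)%N by rewrite expn_gt0.
have kd : (k <= d)%N.
  by rewrite -(@leq_exp2l 2) //; apply: leq_trans ak; rewrite mulSn leq_addr.
pose j := ((2 * a + 1) * 2 ^ k.-1)%N.
have j1 : (a * 2 ^ k < j)%N by rewrite /j ek; nia.
have j2 : (j < a.+1 * 2 ^ k)%N by rewrite /j ek; nia.
have j0 : (0 < j)%N by apply: leq_ltn_trans j1.
(* [j] is the middle column of the block, [y] its height and [p] the midpoint of its top. *)
pose y : R := (d - k.-1)%:R.
pose p : R * R := (j%:R - 1 / 2, y).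
have jx : (a * 2 ^ k)%:R + 1 <= j%:R :> R by rewrite natr1 ler_nat.
have jx' : j%:R + 1 <= (a.+1 * 2 ^ k)%:R :> R by rewrite natr1 ler_nat.
have eR : ((a.+1 * 2 ^ k).-1)%:R = (a.+1 * 2 ^ k)%:R - 1 :> R.
  by rewrite -subn1 natrB //; apply: leq_ltn_trans j2.
have Pp : P p.
  apply: (@block_histogram k a) => //; last by rewrite ler0n lexx.
  by rewrite /in_block eR /=; apply/andP; split; lra.
have : (\bigcup_(s in S) Vrec P s) p by rewrite cov.
case=> s Ss [_ vis]; exists s => //.
have y0 : (d - k)%:R < y by rewrite ltr_nat; clear -kd k0; lia.
have sub x : Num.min s.1 p.1 <= x <= Num.max s.1 p.1 -> P (x, y).
  by move=> hx; apply: vis; split=> //=; rewrite ge_min le_max lexx !orbT.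
split.
  (* A guard outside the block would see [p] along the row at height [y], which passes over the low
     column bounding the block on that side. *)
  rewrite /in_block eR; apply/andP; split.
    rewrite leNgt; apply/negP => lt.
    have [x [x1 x2 x3]] : exists x : R,
        [/\ s.1 <= x, (a * 2 ^ k)%:R - 1 / 2 <= x & x < (a * 2 ^ k)%:R].
      exists (Num.max s.1 ((a * 2 ^ k)%:R - 1 / 2)).
      by rewrite !le_max !lexx orbT gt_max lt; split=> //=; lra.
    apply: (@outside_low_column (a * 2 ^ k) k x y _ _ y0 (sub _ _)); first exact: dvdn_mull.
      by apply/andP; split; lra.
    by rewrite ge_min le_max x1 /=; apply/orP; right; rewrite /p /=; lra.
  rewrite leNgt; apply/negP => lt.
  have [x [x1 x2 x3]] : exists x : R, [/\ x <= s.1, x <= (a.+1 * 2 ^ k)%:R - 1 / 2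
      & (a.+1 * 2 ^ k)%:R - 1 < x].
    exists (Num.min s.1 ((a.+1 * 2 ^ k)%:R - 1 / 2)).
    by rewrite !ge_min !lexx orbT lt_min lt; split=> //=; lra.
  apply: (@outside_low_column (a.+1 * 2 ^ k) k x y _ _ y0 (sub _ _)); first exact: dvdn_mull.
    by apply/andP; split; lra.
  by rewrite ge_min le_max x1 /= andbT; apply/orP; right; rewrite /p /=; lra.
have : P (p.1, s.2) by apply: vis; split; rewrite /= ge_min le_max lexx ?orbT.
move=> /histogramE[i [im h1 /andP[_ h2]]]; apply: le_trans h2 _.
have e : j.-1 = i.
  apply: column_uniq h1; rewrite prednK //.
  have -> : (j.-1)%:R = j%:R - 1 :> R by rewrite -subn1 natrB.
  by rewrite /p /=; apply/andP; split; lra.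
rewrite ler_nat -e prednK //.
by apply: ruler_le; exact: dvdn_mull.
Qed.

(** The guards are distinct because the later ones lie in a half block that the earlier one avoids.
    Each sees the whole base of its block, as all columns there reach up to the height bounding the
    guard. *)
Lemma nested_guards S k a : guard_set P S -> (0 < k)%N -> (a.+1 * 2 ^ k <= 2 ^ d)%N ->
  exists (x : R) (L : seq (R * R)), [/\ in_block k a x, uniq L, size L = k &
    forall s, s \in L -> [/\ S s, in_block k a s.1 & Vrec P s (x, 0)]].
Proof.
move=> gS; elim: k a => // k IH a _ ak.
have [s Ss [sJ s2]] := block_guard gS (ltn0Sn k) ak.
have sees x : in_block k.+1 a x -> Vrec P s (x, 0).
  move=> hx; split; first by apply: (block_histogram (k := k.+1)) hx _ => //; rewrite lexx ler0n.
  move=> u [u1 u2]; rewrite [u]surjective_pairing.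
  have s20 : 0 <= s.2.
    by have [_ SP _] := gS; have /histogramE[i [_ _ /andP[]]] := SP _ Ss.
  apply: (block_histogram (k := k.+1) (a := a)) => //.
    move: u1 hx sJ; rewrite /in_block /= => /andP[h1 h2] /andP[h3 h4] /andP[h5 h6].
    apply/andP; split.
      by apply: le_trans h1; rewrite le_min h5.
    by apply: le_trans h2 _; rewrite ge_max h6.
  move: u2 => /= /andP[h1 h2]; apply/andP; split.
    by apply: le_trans h1; rewrite le_min s20 lexx.
  by apply: le_trans h2 _; rewrite ge_max s2 ler0n.
have [k0|k0] := posnP k.
  exists s.1, [:: s]; split=> //; first by rewrite k0.
  by move=> t; rewrite inE => /eqP ->; split=> //; exact: sees.
have child b : (b <= 1)%N -> forall x, in_block k (2 * a + b) x -> in_block k.+1 a x.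
  move=> hb x /andP[h1 h2]; apply/andP; split.
    by apply: le_trans h1; rewrite ler_nat expnS; clear -hb; nia.
  by apply: le_trans h2 _; rewrite ler_nat expnS; clear -hb; nia.
(* The middle column separates the two halves, so they are disjoint and [s] misses one of them. *)
have [b hb nb] : exists2 b, (b <= 1)%N & ~ in_block k (2 * a + b) s.1.
  have [h0|] := pselect (in_block k (2 * a + 0) s.1); last by exists 0%N.
  exists 1%N => // h1; move: h0 h1 => /andP[_ h0] /andP[h1 _].
  have := le_trans h1 h0; rewrite ler_nat.
  have : (0 < 2 ^ k)%N by rewrite expn_gt0.
  by rewrite addn0 addn1 mulSn; move: (2 ^ k)%N (2 * a * 2 ^ k)%N => c e; clear; lia.
have [|x [L [xJ uL sL hL]]] := IH (2 * a + b)%N k0.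
  by apply: leq_trans ak; rewrite expnS; clear -hb; nia.
exists x, (s :: L); split=> /=.
- exact: child xJ.
- by rewrite uL andbT; apply/negP => /hL[_ sJ' _].
- by rewrite sL.
- move=> t; rewrite inE => /orP[/eqP ->|/hL[St tJ vt]]; first by split=> //; apply: sees; exact: child xJ.
  by split=> //; exact: child tJ.
Qed.

Lemma ruler_colorable S c : guard_set P S -> colorable P S c -> (d <= c)%N.
Proof.
move=> gS [f [fc finc]].
have [|x [L [_ uL sL hL]]] := @nested_guards S d 0 gS d_gt0; first by rewrite mul1n.
rewrite -sL -(size_map f) -(size_iota 0 c); apply: uniq_leq_size.
  rewrite map_inj_in_uniq // => s t /hL[Ss _ vs] /hL[St _ vt] e.
  by apply: contrapT => ne; apply: (finc s t) => //; split=> //; exists (x, 0).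
by move=> _ /mapP[s /hL[Ss _ _] ->]; rewrite mem_iota /= add0n; exact: fc.
Qed.

Lemma ruler_polygon : orthogonal_polygon (2 ^ d.+1) P.
Proof.
have [h1 [h2 h3]] := ruler_bound.
rewrite (_ : 2 ^ d.+1 = 2 * m + 2)%N; last by rewrite expnS -columnsS; lia.
apply: histogram_polygon => //; [exact: ruler_gt0 | exact: ruler_neq].
Qed.

Lemma ruler_chi : (d%:R%:E <= chi_rec P)%E.
Proof.
apply/ereal_infP => _ [S gS <-]; apply/ereal_infP => _ [c cS <-].
by rewrite lee_fin ler_nat; exact: ruler_colorable cS.
Qed.

End Ruler.

Lemma chi_rec_lower (R : realType) : exists c : R, 0 < c /\
    forall N : nat, exists (n : nat) (P : set (R * R)),
      [/\ (N <= n)%N, orthogonal_polygon n P &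
          ((c * ln n%:R)%:E <= chi_rec P)%E].
Proof.
have l2 : 0 < ln 2 :> R by rewrite ln_gt0 // ltr1n.
(* A ruler polygon with [n = 2 ^ N.+2] vertices needs [N.+1] colours, and [N.+2 <= 2 * N.+1]. *)
exists (1 / (2 * ln 2)); split=> [|N]; first by rewrite divr_gt0 // mulr_gt0.
exists (2 ^ N.+2)%N, (@histogram R (2 ^ N.+1).-1 (ruler N.+1)); split.
- by apply: ltnW; apply: ltn_trans (ltn_expl _ (isT : 1 < 2)%N); lia.
- exact: ruler_polygon.
apply: le_trans (ruler_chi R (ltn0Sn N)); rewrite lee_fin natrX lnXn //.
rewrite -[ln 2 *+ _]mulr_natl; have ex : N.+1%:R + 1 = N.+2%:R :> R := natr1 _.
move: N.+2%:R ex => x ex.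
have -> : 1 / (2 * ln 2) * (x * ln 2) = x / 2 by field; rewrite gt_eqF.
by rewrite -ex -[N.+1%:R]natr1; have := ler0n R N; lra.
Qed.

Theorem theorem4 (R : realType) :
  (exists C : R, 0 < C /\
    forall (n : nat) (P : set (R * R)), (4 <= n)%N ->
      orthogonal_polygon n P ->
      (chi_rec P <= (C * ln n%:R)%:E)%E) /\
  (exists c : R, 0 < c /\
    forall N : nat, exists (n : nat) (P : set (R * R)),
      [/\ (N <= n)%N, orthogonal_polygon n P &
          ((c * ln n%:R)%:E <= chi_rec P)%E]).
Proof. by split; [exact: chi_rec_upper | exact: chi_rec_lower]. Qed.
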